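(* Assume the standing assumptions in the context, and let $f\in AC([T,x_0))$. The following properties are equivalent: (i) the finite limit $\gamma:=\lim_{x\to x_0}F^*(x)$ exists; (ii) the finite limit $a_2:=\lim_{x\to x_0}f_2^*(x)$ exists; (iii) both finite limits $a_1:=\lim_{x\to x_0}f_1^*(x)$ and $a_2:=\lim_{x\to x_0}f_2^*(x)$ exist; (iv) there are real numbers $a_1,a_2$ such that, as $x\to x_0$, $$f(x)=a_1\phi_1(x)+a_2\phi_2(x)+o(\phi_2(x)),\qquad \Big(\frac{f(x)}{\phi_1(x)}\Big)'=a_2\Big(\frac{\phi_2(x)}{\phi_1(x)}\Big)'+o\Big(\Big(\frac{\phi_2(x)}{\phi_1(x)}\Big)'\Big);$$ (v) there are real numbers $a_1,a_2$ such that, as $x\to x_0$, $$f(x)=a_1\phi_1(x)+a_2\phi_2(x)+o(\phi_2(x)),\qquad \Big(\frac{f(x)}{\phi_2(x)}\Big)'=a_1\Big(\frac{\phi_1(x)}{\phi_2(x)}\Big)'+o\Big(\frac{\phi_2(x)}{\phi_1(x)}\Big(\frac{\phi_1(x)}{\phi_2(x)}\Big)'\Big);$$ (vi) there are real numbers $a_1,a_2$ and a function $\overline F$, Lebesgue-summable on every compact subinterval of $I$, with $\overline F(x)=o(1)$ as $x\to x_0$ and $$f(x)=a_1\phi_1(x)+a_2\phi_2(x)-\Phi(x)\int_x^{x_0}W(t)\Phi(t)^{-2}\,\overline F(t)\,dt,\qquad x\in(T,x_0);$$ (vii) there are real numbers $a_1,a_2$ and a function $\overline f_2$, Lebesgue-summable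 on every compact subinterval of $I$, with $\overline f_2(x)=o(1)$ as $x\to x_0$ and $$f(x)=a_1\phi_1(x)+a_2\phi_2(x)-\phi_1(x)\int_x^{x_0}\Big(\frac{\phi_2(t)}{\phi_1(t)}\Big)'\,\overline f_2(t)\,dt,\qquad x\in[T,x_0).$$ Moreover, when these properties hold: the constants $a_1,a_2$ appearing in (iii)–(vii) are the same, namely $a_1=\lim_{x\to x_0}f_1^*(x)$, $a_2=\lim_{x\to x_0}f_2^*(x)$; consequently the coefficients of the contact curves $y=f_1^*(\xi)\phi_1(x)+f_2^*(\xi)\phi_2(x)$ converge, as $\xi\to x_0$, to those of $y=a_1\phi_1(x)+a_2\phi_2(x)$; $\gamma=a_1\phi_1(T)+a_2\phi_2(T)$; in (vi) necessarily $\overline F=F^*-\gamma$ a.e. on $I$, and in (vii) necessarily $\overline f_2=f_2^*-a_2$ a.e. on $I$; the limits $$\lim_{x\to x_0}\frac{\phi_1(x)}{\phi_2(x)}\int_x^{x_0}\Big(\frac{\phi_2(t)}{\phi_1(t)}\Big)'f_2^*(t)\,dt=-a_2,\qquad \lim_{x\to x_0}\frac{\Phi(x)}{\phi_2(x)}\int_x^{x_0}W(t)\Phi(t)^{-2}F^*(t)\,dt=-\frac{\gamma}{\phi_2(T)}$$ exist; and the representations $$f(x)=a_1\phi_1(x)+a_2\phi_2(x)-\phi_1(x)\int_x^{x_0}\Big(\frac{\phi_2(t)}{\phi_1(t)}\Big)'[f_2^*(t)-a_2]\,dt,\quad x\in[T,x_0),$$ $$f(x)=a_1\phi_1(x)+a_2\phi_2(x)-\Phi(x)\int_x^{x_0}W(t)\Phi(t)^{-2}[F^*(t)-\gamma]\,dt,\quad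 x\in(T,x_0),$$ hold.
   Context: Let $x_0\in\mathbb{R}\cup\{+\infty\}$, $T\in\mathbb{R}$ with $T<x_0$, and $I:=[T,x_0)$. All limits and asymptotic relations ''as $x\to x_0$'' are taken for $x\in I$ (left-sided); for functions defined only almost everywhere (e.g. those involving $f'$ for $f$ absolutely continuous), limits are taken over the points where they are defined. For differentiable $g,h$ put $W(g,h;x):=g(x)h'(x)-g'(x)h(x)$. Standing assumptions on the comparison functions $\phi_1,\phi_2:I\to\mathbb{R}$: $\phi_1,\phi_2\in C^1(I)$; $\phi_2(x)=o(\phi_1(x))$ as $x\to x_0$; $\phi_1(x)\ne0$ and $\phi_2(x)\neq0$ for all $x\in I$; $W(x):=W(\phi_1,\phi_2;x)\ne 0$ for all $x\in I$. $AC([T,x_0))$ denotes the functions absolutely continuous on every compact subinterval of $I$. For such $f$ and every $t\in I$ at which $f$ is differentiable define $f_1^*(t):=W(f,\phi_2;t)/W(t)$, $f_2^*(t):=-W(f,\phi_1;t)/W(t)$ (so $f_1^*=(f/\phi_2)'/(\phi_1/\phi_2)'$, $f_2^*=(f/\phi_1)'/(\phi_2/\phi_1)'$, and $f_1^*(t)\phi_1+f_2^*(t)\phi_2$ is the unique element of $\mathrm{span}(\phi_1,\phi_2)$ having first-order contact with $f$ at $t$). Put $\Phi(x):=\phi_2(T)\phi_1(x)-\phi_1(T)\phi_2(x)$ and $F^*(t):=\phi_1(T)f_1^*(t)+\phi_2(T)f_2^*(t)=W(\Phi,f;t)/W(t)$. *)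

(* Defs.v *)
From HB Require Import structures.
From mathcomp Require Import all_boot all_order all_algebra.
From mathcomp Require Import all_classical all_reals all_analysis.

Set Implicit Arguments.
Unset Strict Implicit.
Unset Printing Implicit Defensive.

Import Order.TTheory GRing.Theory Num.Theory.
Import numFieldNormedType.Exports.

Local Open Scope classical_set_scope.
Local Open Scope ring_scope.

Definition lmu {R : realType} := @completed_lebesgue_measure R.

Definition Iset {R : realType} (T : R) (x0 : \bar R) : set R :=
  [set x | T <= x /\ (x%:E < x0)%E].

(* The filter "x -> x0" (left-sided when x0 is finite, x -> +oo otherwise).
   The case x0 = -oo is excluded by the hypothesis T < x0 of the theorem. *)
Definition to_x0 {R : realType} (x0 : \bar R) : set_system R :=
  match x0 with
  | EFin r => r^'-
  | +oo%E => +oo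
  | -oo%E => -oo
  end.

Definition Dset {R : realType} (g : R -> R) : set R :=
  [set t | derivable g t 1].

(* The filter "x -> x0 over the points where f is differentiable"
   (used for limits of quantities involving f'). *)
Definition to_x0_D {R : realType} (x0 : \bar R) (f : R -> R) : set_system R :=
  within (Dset f) (to_x0 x0).

Definition Wr {R : realType} (g h : R -> R) (x : R) : R :=
  g x * derive1 h x - derive1 g x * h x.

Definition fstar1 {R : realType} (phi1 phi2 f : R -> R) (t : R) : R :=
  Wr f phi2 t / Wr phi1 phi2 t.
Definition fstar2 {R : realType} (phi1 phi2 f : R -> R) (t : R) : R :=
  - Wr f phi1 t / Wr phi1 phi2 t.
Definition Phi {R : realType} (T : R) (phi1 phi2 : R -> R) (x : R) : R :=
  phi2 T * phi1 x - phi1 T * phi2 x.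
Definition Fstar {R : realType} (T : R) (phi1 phi2 f : R -> R) (t : R) : R :=
  phi1 T * fstar1 phi1 phi2 f t + phi2 T * fstar2 phi1 phi2 f t.

Definition C1_on {R : realType} (T : R) (x0 : \bar R) (phi : R -> R) : Prop :=
  (forall x, Iset T x0 x -> derivable phi x 1) /\
  {within Iset T x0, continuous (derive1 phi)}.

Definition abs_cont_on {R : realType} (a b : R) (f : R -> R) : Prop :=
  forall e : R, 0 < e -> exists d : R, 0 < d /\
    forall (n : nat) (u v : nat -> R),
      (forall k, (k < n)%N -> a <= u k /\ u k <= v k /\ v k <= b) ->
      (forall k l, (k < l)%N -> (l < n)%N -> v k <= u l) ->
      \sum_(k < n) (v k - u k) < d ->
      \sum_(k < n) `|f (v k) - f (u k)| < e.

Definition AC_on {R : realType} (T : R) (x0 : \bar R) (f : R -> R) : Prop :=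
  forall a b, T <= a -> (b%:E < x0)%E -> abs_cont_on a b f.

Definition loc_summable {R : realType} (T : R) (x0 : \bar R) (g : R -> R) : Prop :=
  forall a b, T <= a -> (b%:E < x0)%E ->
    (@lmu R).-integrable `[a, b] (EFin \o g).

Definition little_o {R : realType} (F : set_system R) (h g : R -> R) : Prop :=
  forall e : R, 0 < e -> \forall x \near F, `|h x| <= e * `|g x|.

Definition imp_int {R : realType} (x0 : \bar R) (g : R -> R) (x L : R) : Prop :=
  (forall b, (b%:E < x0)%E -> (@lmu R).-integrable `[x, b] (EFin \o g)) /\
  (fun b => \int[@lmu R]_(t in `[x, b]) g t) @ to_x0 x0 --> L.

Section props.
Context {R : realType} (T : R) (x0 : \bar R) (phi1 phi2 f : R -> R).

Let fx0 := to_x0_D x0 f.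

Definition prop_i : Prop :=
  exists gamma : R, Fstar T phi1 phi2 f @ fx0 --> gamma.

Definition prop_ii : Prop :=
  exists a2 : R, fstar2 phi1 phi2 f @ fx0 --> a2.

Definition cond_iii (a1 a2 : R) : Prop :=
  fstar1 phi1 phi2 f @ fx0 --> a1 /\ fstar2 phi1 phi2 f @ fx0 --> a2.

Definition cond_iv (a1 a2 : R) : Prop :=
  little_o (to_x0 x0) (fun x => f x - (a1 * phi1 x + a2 * phi2 x)) phi2 /\
  little_o fx0
    (fun x => derive1 (fun y => f y / phi1 y) x
              - a2 * derive1 (fun y => phi2 y / phi1 y) x)
    (derive1 (fun y => phi2 y / phi1 y)).

Definition cond_v (a1 a2 : R) : Prop :=
  little_o (to_x0 x0) (fun x => f x - (a1 * phi1 x + a2 * phi2 x)) phi2 /\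
  little_o fx0
    (fun x => derive1 (fun y => f y / phi2 y) x
              - a1 * derive1 (fun y => phi1 y / phi2 y) x)
    (fun x => phi2 x / phi1 x * derive1 (fun y => phi1 y / phi2 y) x).

Definition rep_vi (a1 a2 : R) (Fb : R -> R) : Prop :=
  forall x, T < x -> (x%:E < x0)%E ->
    exists L, imp_int x0
      (fun t => Wr phi1 phi2 t / (Phi T phi1 phi2 t ^+ 2) * Fb t) x L /\
    f x = a1 * phi1 x + a2 * phi2 x - Phi T phi1 phi2 x * L.

Definition cond_vi (a1 a2 : R) (Fb : R -> R) : Prop :=
  loc_summable T x0 Fb /\ little_o (to_x0 x0) Fb (fun=> 1) /\ rep_vi a1 a2 Fb.

Definition rep_vii (a1 a2 : R) (fb2 : R -> R) : Prop :=
  forall x, Iset T x0 x ->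
    exists L, imp_int x0
      (fun t => derive1 (fun y => phi2 y / phi1 y) t * fb2 t) x L /\
    f x = a1 * phi1 x + a2 * phi2 x - phi1 x * L.

Definition cond_vii (a1 a2 : R) (fb2 : R -> R) : Prop :=
  loc_summable T x0 fb2 /\ little_o (to_x0 x0) fb2 (fun=> 1) /\ rep_vii a1 a2 fb2.

End props.

(* Main.v *)
(* Each coefficient is a quotient of derivatives: fstar2 = (f/phi1)' / (phi2/phi1)'
   and Fstar = (f/Phi)' / v' with v = phi1 / (phi1(T) Phi), v' = W / Phi^2.  In both
   cases g' = q v' almost everywhere, with v strictly monotone and convergent at x0.
   If q tends to ga, the fundamental theorem of calculus for absolutely continuous
   functions gives |D(g - ga v)| <= e |D v| for increments D near x0, so g - ga v
   converges and its tail is the improper integral of v' (q - ga).  Conversely, a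
   representation g = A + ga v - int_x^x0 v' F with F = o(1) gives the same increment
   bound and hence, dividing by increments of v, |q - ga| <= e at every point of
   differentiability.  The pairs (fstar1, fstar2) and (Fstar, f/Phi) determine each
   other through f = fstar1 phi1 + fstar2 phi2.

   For the fundamental theorem itself, f is split into its variation function V and
   V - f, both nondecreasing and absolutely continuous; their Lebesgue-Stieltjes
   measures are dominated by Lebesgue measure and the Radon-Nikodym density is f'
   almost everywhere by Lebesgue differentiation. *)

Require Import Defs.
From HB Require Import structures.
From mathcomp Require Import all_boot all_order all_algebra.
From mathcomp Require Import all_classical all_reals all_analysis.
From mathcomp Require Import measurable_realfun ring lra.

Import Order.TTheory GRing.Theory Num.Theory.
Import numFieldNormedType.Exports.

Local Open Scope classical_set_scope.
Local Open Scope ring_scope.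

Set Implicit Arguments.
Unset Strict Implicit.

(** * Absolute continuity and total variation *)

Section absolute_continuity.
Context {R : realType}.
Implicit Types (a b lo mid hi x y : R) (f g : R -> R) (s : seq (R * R)).

(** The limits of the coefficients run over every point where [f] is differentiable, whereas
    absolute continuity yields identities only almost everywhere, and such an identity does not by
    itself carry a limit of this kind. Increments of [g - ga v] are defined everywhere and serve as
    the bridge in both directions. A second obstacle is that [Phi] vanishes at [T]: [f / Phi] and
    [v] are usable only on [[c, x0)] with [c > T]. The common results are therefore stated for an
    arbitrary left end [c]; what concerns all of [[T, x0)] comes from a sequence of such [c], or
    from the quotient by [phi1], which is harmless at [T]. The measure [lmu] is the completed one,
    under which a function altered on a null set stays measurable. Stieltjes measures and their
    densities are Borel objects, so transfer lemmas join the two settings. All seven properties are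
    compared with one predicate, [limits], which records the limit of [fstar2] and that of
    [f / phi1 - a2 phi2 / phi1]. *)

Fixpoint ordered_in lo hi s : bool :=
  if s is p :: s' then [&& lo <= p.1, p.1 <= p.2 & ordered_in p.2 hi s']
  else lo <= hi.

Definition incr f s : R := \sum_(p <- s) `|f p.2 - f p.1|.

(** Families of intervals are lists instead of indexed endpoints, so that they can be concatenated,
    refined and treated by induction. Here [incr id s] is the total length of the family. *)
Definition ac a b f : Prop := forall e : R, 0 < e -> exists2 d : R, 0 < d &
  forall s, ordered_in a b s -> incr id s < d -> incr f s < e.

Lemma ordered_in_le lo hi s : ordered_in lo hi s -> lo <= hi.
Proof.
elim: s lo => //= p s IH lo /and3P[h1 h2 /IH]; exact/le_trans/(le_trans h1).
Qed.

Lemma ordered_inW lo hi lo' hi' s : lo' <= lo -> hi <= hi' ->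
  ordered_in lo hi s -> ordered_in lo' hi' s.
Proof.
move=> + hh; elim: s lo lo' => /= [|p s IH] lo lo' ll.
  by move=> h; rewrite (le_trans ll)// (le_trans h).
by move=> /and3P[h1 -> /IH->//]; rewrite (le_trans ll).
Qed.

Lemma ordered_in_cat lo mid hi s t : ordered_in lo mid s ->
  ordered_in mid hi t -> ordered_in lo hi (s ++ t).
Proof.
elim: s lo => /= [|p s IH] lo.
  by move=> h; apply: ordered_inW.
by move=> /and3P[-> -> /IH h] /h.
Qed.

Lemma ordered_in_nth lo hi s k : ordered_in lo hi s -> (k < size s)%N ->
  let p := nth (hi, hi) s k in [/\ lo <= p.1, p.1 <= p.2 & p.2 <= hi].
Proof.
elim: s lo k => //= p s IH lo [|k] /and3P[h1 h2 h3] /=.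
  by split => //; apply: ordered_in_le h3.
rewrite ltnS => /(IH _ _ h3)[h4 h5 h6]; split=> //.
by rewrite (le_trans h1)// (le_trans h2).
Qed.

Lemma ordered_in_nth2 lo hi s k l : ordered_in lo hi s ->
  (k < l)%N -> (l < size s)%N ->
  (nth (hi, hi) s k).2 <= (nth (hi, hi) s l).1.
Proof.
elim: s lo k l => //= p s IH lo [|k] [|l]// /and3P[h1 h2 h3] /=.
  by move=> _; rewrite ltnS => /(ordered_in_nth h3)[].
by rewrite !ltnS; apply: IH h3.
Qed.

Lemma incr_cons f p s : incr f (p :: s) = `|f p.2 - f p.1| + incr f s.
Proof. by rewrite /incr big_cons. Qed.

Lemma incr_cat f s t : incr f (s ++ t) = incr f s + incr f t.
Proof. by rewrite /incr big_cat. Qed.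

Lemma incr_ge0 f s : 0 <= incr f s.
Proof. by rewrite /incr sumr_ge0. Qed.

Lemma incr_nth f s (p0 : R * R) :
  incr f s = \sum_(k < size s) `|f (nth p0 s k).2 - f (nth p0 s k).1|.
Proof. by rewrite /incr (big_nth p0) big_mkord. Qed.

Lemma abs_cont_on_ac a b f : abs_cont_on a b f -> ac a b f.
Proof.
move=> H e /H[d [d0 {}H]]; exists d => // s so sd.
rewrite (incr_nth _ _ (b, b)).
apply: (H _ (fun k => (nth (b, b) s k).1) (fun k => (nth (b, b) s k).2)).
- by move=> k /(ordered_in_nth so)[].
- by move=> k l; apply: ordered_in_nth2 so.
- rewrite (le_lt_trans _ sd)// (incr_nth _ _ (b, b)).
  by apply: ler_sum => i _; rewrite ler_norm.
Qed.

Lemma acW a b a' b' f : a <= a' -> b' <= b -> ac a b f -> ac a' b' f.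
Proof.
move=> aa bb H e /H[d d0 {}H]; exists d => // s so; apply: H.
exact: ordered_inW so.
Qed.

(** Neighbouring points of a partition bound adjacent intervals, so a partition becomes a family to
    which the modulus of [ac] applies. *)
Lemma variation_incr x y f l : itv_partition x y l ->
  exists s, [/\ ordered_in x y s, incr f s = variation x y f l &
               incr id s <= y - x].
Proof.
elim: l x => [|z l IH] x.
  move=> [_ /= /eqP ->]; exists [::].
  by split; rewrite /= ?lexx// /incr big_nil ?subrr// /variation big_geq.
move=> [/= /andP[xz pl] zl].
have zyl : itv_partition z y l by split.
have [s [so sv sl]] := IH _ zyl.
exists ((x, z) :: s); split => /=.
- by rewrite lexx ltW.
- by rewrite incr_cons sv /variation/= big_nat_recl.
- by rewrite incr_cons/= gtr0_norm ?subr_gt0// addrC -lerBrDr (le_trans sl)// opprB addrA subrK.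
Qed.

(** Partitioning each interval of [s] refines it into a family of no greater length, for which [C]
    is a bound; suprema over these partitions are then taken one interval at a time. In the
    induction [C] is lowered by the variation along the partition chosen for the first interval. *)
Lemma sum_total_variation_le b f lo s (C : R) : ordered_in lo b s ->
  (forall t, ordered_in lo b t -> incr id t <= incr id s -> incr f t <= C) ->
  (\sum_(p <- s) total_variation p.1 p.2 f <= C%:E)%E.
Proof.
elim: s lo C => [lo C h H|p s IH lo C /= /and3P[h1 h2 h3] H].
  by rewrite big_nil lee_fin; apply: (le_trans (incr_ge0 f [::])); exact: H.
rewrite big_cons.
have key l : itv_partition p.1 p.2 l ->
    (\sum_(p <- s) total_variation p.1 p.2 f <= (C - variation p.1 p.2 f l)%:E)%E.
  move=> /(variation_incr f)[t [to tv tl]].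
  apply: IH h3 _ => t' t'o t'l.
  rewrite lerBrDl -tv -incr_cat H//.
    by apply: ordered_in_cat t'o; apply: ordered_inW to.
  by rewrite incr_cat incr_cons lerD// (le_trans tl)// ler_norm.
have TV0 : (0 <= \sum_(p <- s) total_variation p.1 p.2 f)%E.
  rewrite big_seq sume_ge0// => q qs; apply: total_variation_ge0.
  move: (nth_index (b, b) qs) => <-.
  by have [] := ordered_in_nth h3 (k := index q s); rewrite ?index_mem.
(* The remaining sum must be finite before it can be moved across the inequality in the extended
   reals. *)
have : (\sum_(p <- s) total_variation p.1 p.2 f)%E \is a fin_num.
  have [l pl] : exists l, itv_partition p.1 p.2 l.
    case: (ltrgtP p.1 p.2) h2 => // [lt|->] _; last by exists [::]; split => /=.
    by exists [:: p.2]; exact: itv_partition1.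
  by rewrite ge0_fin_numE// (le_lt_trans (key _ pl))// ltry.
move=> fin; rewrite -leeBrDr//; apply: ge_ereal_sup => _ [_ [l pl <-] <-].
by rewrite leeBrDr// addeC -leeBrDr// key.
Qed.

(** With [d] the modulus for the value 1, an interval shorter than [d] has variation at most 1, and
    finitely many steps of length [d / 2] reach [b] from [a]. *)
Lemma ac_bounded_variation a b f : a <= b -> ac a b f -> bounded_variation a b f.
Proof.
move=> ab H; have [d d0 {}H] := H _ ltr01.
have small x y : a <= x -> x <= y -> y <= b -> y - x < d ->
    total_variation x y f \is a fin_num.
  move=> ax xy yb xyd.
  have := @sum_total_variation_le b f a [:: (x, y)] 1.
  rewrite /= ax xy yb big_seq1 => /(_ isT) h.
  rewrite ge0_fin_numE ?total_variation_ge0// (le_lt_trans (h _)) ?ltry//.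
  move=> t to tl; rewrite ltW// H// (le_lt_trans tl)//.
  by rewrite /incr big_seq1/= ger0_norm ?subr_ge0.
suff : forall n x, a <= x -> x <= b -> x - a <= (d / 2) *+ n ->
    total_variation a x f \is a fin_num.
  move=> /(_ (Num.truncn ((b - a) / (d / 2))).+1 b ab (lexx _)) h.
  apply/bounded_variationP => //; apply: h.
  rewrite -mulr_natr mulrC -ler_pdivrMr ?divr_gt0//.
  by rewrite ltW// truncnS_gt.
elim => [|n IH] x ax xb xn.
  have -> : x = a by apply/eqP; rewrite eq_le ax -subr_le0 -(mulr0n (d / 2)) xn.
  by rewrite total_variationxx.
rewrite (mulrS (d / 2)) in xn.
(* One step to the left, stopped at [a]; half of [d] secures the strict bound [x - z < d]. *)
pose z := Num.max a (x - d / 2).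
have az : a <= z by rewrite /z le_max lexx.
have d20 : 0 < d / 2 by rewrite divr_gt0.
have zx : z <= x by rewrite /z ge_max ax/= lerBlDr lerDl ltW.
rewrite (total_variationD f az zx) fin_numD IH//=.
- apply: small => //; rewrite ltrBlDr -ltrBlDl /z lt_max; apply/orP; right.
  by rewrite ltrD2l ltrN2 ltr_pdivrMr// ltr_pMr// ltr1n.
- exact: le_trans zx xb.
- by rewrite /z lerBlDr ge_max; apply/andP; split; [rewrite lerDr mulrn_wge0// ltW|move: xn; set w := _ *+ n => xn; lra].
Qed.

Definition variation_fun a f x : R := fine (total_variation a x f).

Section variation_fun.
Variables (a b : R) (f : R -> R).
Hypotheses (ab : a <= b) (acf : ac a b f).
Let V := variation_fun a f.

Let fin x y : a <= x -> x <= y -> y <= b -> total_variation x y f \is a fin_num.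
Proof.
move=> ax xy yb; apply/bounded_variationP => //; apply: ac_bounded_variation => //.
exact: acW acf.
Qed.

Lemma variation_funB x y : a <= x -> x <= y -> y <= b ->
  (V y - V x)%:E = total_variation x y f.
Proof.
move=> ax xy yb; have ay := le_trans ax xy; have xb := le_trans xy yb.
rewrite /V /variation_fun (total_variationD f ax xy) fineD ?fin//.
by rewrite addrC addKr fineK// fin.
Qed.

Lemma variation_fun_ge x y : a <= x -> x <= y -> y <= b ->
  `|f y - f x| <= V y - V x.
Proof.
by move=> ax xy yb; rewrite -lee_fin variation_funB// total_variation_ge.
Qed.

(** The modulus of [f] for [e / 2] also serves [V], because refining a short family keeps it short.
    The half absorbs the loss of strictness in the supremum. *)
Lemma variation_fun_ac : ac a b V.
Proof.
move=> e e0; have /acf[d d0 H] : 0 < e / 2 by rewrite divr_gt0.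
exists d => // s so sd; suff : incr V s <= e / 2.
  by move=> /le_lt_trans; apply; rewrite ltr_pdivrMr// ltr_pMr// ltr1n.
rewrite -lee_fin; apply: le_trans (sum_total_variation_le (f := f) so _).
  rewrite /incr -sumEFin big_seq [leRHS]big_seq; apply: lee_sum => q qs.
  have := ordered_in_nth so (k := index q s).
  rewrite index_mem qs nth_index// => /(_ isT)[h1 h2 h3].
  rewrite -variation_funB// lee_fin ger0_norm//.
  by rewrite (le_trans _ (variation_fun_ge _ _ _)).
by move=> t to tl; rewrite ltW// H// (le_lt_trans tl).
Qed.

End variation_fun.

Lemma acB a b f g : ac a b f -> ac a b g -> ac a b (fun x => f x - g x).
Proof.
move=> F G e e0; have e2 : 0 < e / 2 by rewrite divr_gt0.
have [d d0 {}F] := F _ e2; have [d' d'0 {}G] := G _ e2.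
exists (Num.min d d') => [|s so]; first by rewrite lt_min d0.
rewrite lt_min => /andP[/(F _ so) h1 /(G _ so) h2].
rewrite (splitr e) (le_lt_trans _ (ltrD h1 h2))// /incr -big_split/=.
apply: ler_sum => p _; apply: le_trans (ler_normB _ _).
by rewrite le_eqVlt; apply/orP; left; apply/eqP; congr `|_|; ring.
Qed.

Lemma ac_lipschitz a b f (K : R) :
  (forall x y, a <= x -> x <= y -> y <= b -> `|f y - f x| <= K * `|y - x|) -> ac a b f.
Proof.
move=> H e e0; exists (e / (`|K| + 1)) => [|s so]; first by rewrite divr_gt0// ltr_wpDl.
rewrite ltr_pdivlMr ?ltr_wpDl// => /(le_lt_trans _); apply.
rewrite mulrC /incr mulr_sumr big_seq [leRHS]big_seq; apply: ler_sum => q qs.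
have := ordered_in_nth so (k := index q s).
rewrite index_mem qs nth_index// => /(_ isT)[h1 h2 h3].
rewrite (le_trans (H _ _ _ _ _))// ler_wpM2r//.
by rewrite (le_trans (ler_norm _))// lerDl.
Qed.

Lemma ac_bounded a b f : ac a b f -> exists M, forall x, a <= x -> x <= b -> `|f x| <= M.
Proof.
move=> acf; exists (`|f a| + variation_fun a f b) => x ax xb.
have ab := le_trans ax xb.
have h := variation_fun_ge acf (lexx a) ax xb.
have h' := variation_fun_ge acf ax xb (lexx b).
have h0 : variation_fun a f a = 0.
  by rewrite /variation_fun total_variationxx.
have -> : f x = f a + (f x - f a) by ring.
rewrite (le_trans (ler_normD _ _))// lerD2l (le_trans h)// h0 subr0.
by rewrite -subr_ge0 (le_trans _ h').
Qed.

Lemma acM a b f g : ac a b f -> ac a b g -> ac a b (fun x => f x * g x).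
Proof.
move=> F G; have [M FM] := ac_bounded F; have [N GN] := ac_bounded G.
(* [M] and [N] bound nothing when [a > b] and may then be negative; the last two terms make [C]
   positive in every case. *)
move=> e e0; pose C := Num.max M N + `|M| + 1.
have C0 : 0 < C.
  rewrite /C ltr_wpDl// (le_trans (_ : 0 <= M + `|M|))// ?lerD2r ?le_max ?lexx//.
  by rewrite -lerBlDr sub0r lerNl -normrN ler_norm.
have MC : M <= C by rewrite /C -addrA ler_wpDr ?addr_ge0// le_max lexx.
have NC : N <= C by rewrite /C -addrA ler_wpDr ?addr_ge0// le_max lexx orbT.
have e2 : 0 < e / 2 / C by rewrite !divr_gt0.
have [d d0 {}F] := F _ e2; have [d' d'0 {}G] := G _ e2.
exists (Num.min d d') => [|s so]; first by rewrite lt_min d0.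
rewrite lt_min => /andP[/(F _ so) h1 /(G _ so) h2].
rewrite ltr_pdivlMr// in h1; rewrite ltr_pdivlMr// in h2.
rewrite (splitr e) (le_lt_trans _ (ltrD h1 h2))// /incr !mulr_suml -big_split/=.
rewrite big_seq [leRHS]big_seq; apply: ler_sum => q qs.
have := ordered_in_nth so (k := index q s).
rewrite index_mem qs nth_index// => /(_ isT)[h3 h4 h5].
have -> : f q.2 * g q.2 - f q.1 * g q.1 = (f q.2 - f q.1) * g q.2 + (g q.2 - g q.1) * f q.1 by ring.
rewrite (le_trans (ler_normD _ _))// !normrM lerD// ler_wpM2l//.
  by rewrite (le_trans _ NC)// GN// (le_trans h3).
by rewrite (le_trans _ MC)// FM// (le_trans h4).
Qed.

End absolute_continuity.

(** * Stieltjes measures of absolutely continuous functions *)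

Section stieltjes.
Context {R : realType}.
Implicit Types (a b p q lo hi : R) (g : R -> R) (s : seq (R * R)).

Definition covered s : set R := [set x | has (fun c : R * R => (c.1 < x) && (x <= c.2)) s].

(* Fusing the intervals that meet ]p, q] keeps the list ordered without increasing
   its total length, so disjointification needs no measure theory. *)
Fixpoint merge_itv p q s :=
  if s is c :: s' then
    if q <= c.1 then (p, q) :: s
    else if c.2 <= p then c :: merge_itv p q s'
    else merge_itv (Num.min p c.1) (Num.max q c.2) s'
  else [:: (p, q)].

Lemma merge_itv_ordered p q s lo hi : lo <= p -> p <= q -> q <= hi ->
  ordered_in lo hi s -> ordered_in lo hi (merge_itv p q s).
Proof.
elim: s p q lo => /= [|c s IH] p q lo lp pq qh.
  by move=> _; rewrite lp pq qh.
move=> /and3P[h1 h2 h3]; case: ifPn => [qc|qc] /=.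
  by rewrite lp pq qc h2.
case: ifPn => [cp|cp] /=; first by rewrite h1 h2 IH.
have h4 := ordered_in_le h3.
apply: IH; rewrite ?le_min ?lp ?h1// ?ge_max ?qh//.
  by rewrite le_max ge_min pq.
by apply: ordered_inW h3 => //; apply: le_trans h2.
Qed.

Lemma merge_itv_length p q s lo hi : lo <= p -> p <= q -> q <= hi ->
  ordered_in lo hi s -> incr id (merge_itv p q s) <= (q - p) + incr id s.
Proof.
elim: s p q lo => /= [|c s IH] p q lo lp pq qh.
  by move=> _; rewrite incr_cons/= ger0_norm// subr_ge0.
move=> /and3P[h1 h2 h3]; have h4 := ordered_in_le h3.
case: ifPn => [qc|]; first by rewrite incr_cons/= ger0_norm// subr_ge0.
rewrite -ltNge => qc; case: ifPn => [cp|].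
  rewrite !incr_cons addrCA lerD2l.
  by apply: (IH _ _ c.2).
rewrite -ltNge => cp.
have /le_trans -> // : incr id (merge_itv (Num.min p c.1) (Num.max q c.2) s) <=
   Num.max q c.2 - Num.min p c.1 + incr id s.
  apply: (IH _ _ lo); rewrite ?le_min ?lp ?h1// ?ge_max ?qh//.
    by rewrite le_max ge_min pq.
  by apply: ordered_inW h3 => //; apply: le_trans h2.
(* It remains to see that the hull of two intervals that meet is no longer than both lengths
   together. *)
rewrite incr_cons addrA lerD2r/= ger0_norm ?subr_ge0//.
by rewrite maxEle minEle; case: ifP => _; case: ifP => _; lra.
Qed.

Lemma merge_itv_covered p q s : p <= q ->
  `]p, q] `|` covered s `<=` covered (merge_itv p q s).
Proof.
elim: s p q => /= [|c s IH] p q pq.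
  by move=> x [|//]; rewrite /= in_itv/= /covered/= => ->.
case: ifPn => [qc|_].
  by move=> x [|]; rewrite /covered/= ?in_itv/= => -> //; rewrite orbT.
case: ifPn => [cp|_] x.
  move=> H; rewrite /covered/=; case: (boolP ((c.1 < x) && (x <= c.2))) => //= Hn.
  apply: IH => //; case: H; [by left|].
  by rewrite /covered/= (negbTE Hn); right.
have pq' : Num.min p c.1 <= Num.max q c.2 by rewrite ge_min !le_max pq.
case=> [|]; rewrite /covered/= ?in_itv/=.
  move=> /andP[h1 h2]; apply: IH => //; left.
  by rewrite /= in_itv/= gt_min le_max h1 h2.
move=> /orP[/andP[h1 h2]|h]; apply: IH => //; [left|by right].
by rewrite /= in_itv/= gt_min le_max h1 h2 !orbT.
Qed.

Local Notation LS := (@lebesgue_stieltjes_measure R).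

Lemma coveredE s : covered s = \big[setU/set0]_(c <- s) `]c.1, c.2]%classic.
Proof.
elim: s => [|p s IH]; first by rewrite big_nil; apply/seteqP; split.
rewrite big_cons -IH; apply/seteqP; split => x; rewrite /covered/= ?in_itv/=.
  by move=> /orP[]; [left|right].
by case=> ->//; rewrite orbT.
Qed.

Lemma measurable_covered s : measurable (covered s : set (measurableTypeR R)).
Proof.
by rewrite coveredE; apply: bigsetU_measurable => p _; exact: measurable_itv.
Qed.

Lemma stieltjes_itv (g : cumulative R R) a b : a <= b ->
  LS g `]a, b]%classic = (g b - g a)%:E.
Proof.
move=> ab; rewrite /lebesgue_stieltjes_measure/= /measure_extension.
rewrite measurable_mu_extE/=; last exact: is_ocitv.
by rewrite wlength_itv_bnd.
Qed.

Lemma stieltjes_covered (g : cumulative R R) lo hi s : ordered_in lo hi s ->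
  (LS g (covered s) <= (incr g s)%:E)%E.
Proof.
elim: s lo => /= [|p s IH] lo.
  by rewrite coveredE big_nil measure0 lee_fin incr_ge0.
move=> /and3P[_ h2 /IH h3]; rewrite incr_cons EFinD.
rewrite coveredE big_cons -coveredE.
have mp : measurable (`]p.1, p.2]%classic : set (measurableTypeR R)).
  exact: measurable_itv.
apply: le_trans (measureU2 (LS g) mp (measurable_covered s)) _.
apply: leeD => //.
by apply: (@le_trans _ _ (g p.2 - g p.1)%:E);
  [rewrite -stieltjes_itv|rewrite lee_fin ler_norm].
Qed.

(** A null set has a countable cover by half-open intervals of total length below [d]. These may
    overlap, while the hypothesis speaks of ordered families, so the first [n] are fused; the
    resulting bound [e] on finite unions passes to the whole cover by continuity from below. *)
Lemma stieltjes_dominates (g : cumulative R R) :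
  (forall e : R, 0 < e -> exists2 d : R, 0 < d & forall lo hi s,
     ordered_in lo hi s -> incr id s < d -> incr g s < e) ->
  LS g `<< (@lebesgue_measure R).
Proof.
move=> acg; apply/null_content_dominatesP => A mA A0.
apply/eqP; rewrite -measure_le0; apply/lee_addgt0Pr => e e0; rewrite add0e.
have [d d0 H] := acg _ e0.
have : (lebesgue_measure A < d%:E)%E by rewrite A0 lte_fin.
(* Lebesgue measure is unfolded here as an infimum over countable covers by half-open intervals. *)
move=> /ereal_inf_lt[_ /= [F [mF AF] <-] Fd].
have FE k : exists p : R * R, p.1 <= p.2 /\ F k = `]p.1, p.2]%classic.
  have /ocitvP[->|[p /ltW p12 ->]] := mF k; last by exists p.
  by exists (0, 0); rewrite lexx set_itvoc0.
have /choice[c /all_and2[c12 cF]] := FE.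
pose s n := iteri n (fun k => merge_itv (c k).1 (c k).2) [::].
have Fk0 k : (0 <= wlength idfun (F k))%E by exact: wlength_ge0.
have wFE k : wlength idfun (F k) = ((c k).2 - (c k).1)%:E.
  by rewrite cF wlength_itv_bnd.
have os n : exists lo hi, ordered_in lo hi (s n) /\
    incr id (s n) <= \sum_(k < n) ((c k).2 - (c k).1).
  elim: n => [|n [lo [hi [h1 h2]]]].
    by exists 0, 0; rewrite /= lexx /incr big_nil big_ord0.
  pose lo' := Num.min lo (c n).1; pose hi' := Num.max hi (c n).2.
  have h3 : ordered_in lo' hi' (s n).
    by apply: ordered_inW h1; rewrite ?ge_min ?le_max lexx.
  have h4 : lo' <= (c n).1 by rewrite ge_min lexx orbT.
  have h5 : (c n).2 <= hi' by rewrite le_max lexx orbT.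
  exists lo', hi'; split => /=; first exact: merge_itv_ordered.
  rewrite big_ord_recr/= addrC (le_trans (merge_itv_length _ _ _ h3))//.
  by rewrite lerD2l.
have covs n : \big[setU/set0]_(k < n) F k `<=` covered (s n).
  elim: n => [|n IH]; first by rewrite big_ord0.
  rewrite big_ord_recr/= => x [/IH|] Hx; apply: merge_itv_covered => //.
    by right.
  by left; rewrite -cF.
have mF' k : measurable (F k : set (measurableTypeR R)).
  by rewrite cF; exact: measurable_itv.
pose U n := \big[setU/set0]_(k < n.+1) F k.
have mU n : measurable (U n : set (measurableTypeR R)).
  by apply: bigsetU_measurable => k _; exact: mF'.
have UF : \bigcup_n F n = \bigcup_n U n.
  by rewrite -(bigcup_bigsetU_bigcup F).
have mUU : measurable (\bigcup_n U n : set (measurableTypeR R)).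
  exact: bigcupT_measurable.
apply: (@le_trans _ _ (LS g (\bigcup_n U n))).
  by apply: le_measure; rewrite ?inE// -UF.
have nU : {homo U : n m / (n <= m)%N >-> (n <= m)%O}.
  by move=> n m nm; rewrite subsetEset; exact: subset_bigsetU.
have cv := @nondecreasing_cvg_mu _ _ _ (LS g) U mU mUU nU.
rewrite -(cvg_lim _ cv)//; apply: lime_le; first by apply/cvg_ex; eexists; exact: cv.
apply: nearW => n /=; have [lo [hi [h1 h2]]] := os n.+1.
apply: (@le_trans _ _ (LS g (covered (s n.+1)))).
  apply: (le_measure (LS g)); [| |exact: covs]; rewrite inE.
    exact: mU.
  exact: measurable_covered.
apply: le_trans (stieltjes_covered g h1) _.
rewrite lee_fin ltW// (H _ _ _ h1)// (le_lt_trans h2)//.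
rewrite -lte_fin (le_lt_trans _ Fd)// -sumEFin.
under eq_bigr do rewrite -wFE.
by rewrite -(big_mkord xpredT (fun k => wlength idfun (F k))); apply: nneseries_lim_ge.
Qed.

(** Restricting the Stieltjes measure to []a, b]] makes it finite, so that its density is integrable
    on the whole line. Right continuity, required of a cumulative function, is the modulus applied
    to a single interval. *)
Lemma stieltjes_density g a b : a <= b -> {homo g : x y / x <= y} ->
  (forall e : R, 0 < e -> exists2 d : R, 0 < d & forall lo hi s,
     ordered_in lo hi s -> incr id s < d -> incr g s < e) ->
  exists h : R -> R, (@lebesgue_measure R).-integrable setT (EFin \o h) /\
    forall x, a <= x -> x <= b ->
      g x - g a = \int[@lebesgue_measure R]_(t in `]a, x]) h t.
Proof.
move=> ab ndg acg.
have rcg : right_continuous g.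
  move=> x; apply/cvgrPdist_lt => e e0; have [d d0 H] := acg _ e0.
  near=> y; have xy : x < y by near: y; exact: nbhs_right_gt.
  rewrite distrC; have := H x y [:: (x, y)].
  rewrite /= !lexx (ltW xy) /incr !big_seq1/=; apply => //.
  rewrite gtr0_norm ?subr_gt0// ltrBlDl; near: y.
  by apply: nbhs_right_lt; rewrite ltrDl.
pose G : cumulative R R := HB.pack g (isCumulative.Build _ _ _ _ ndg rcg).
have mD : measurable (`]a, b]%classic : set (measurableTypeR R)) by exact: measurable_itv.
have finD : (LS G `]a, b]%classic < +oo)%E by rewrite stieltjes_itv// ltry.
pose nu : {finite_measure set _ -> \bar R} := mfrestr mD finD.
have nu_dom : nu `<< (@lebesgue_measure R).
  have dom := stieltjes_dominates (g := G) acg.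
  apply/null_content_dominatesP => A mA A0.
  have /null_content_dominatesP := dom; apply; first exact: measurableI.
  apply/eqP; rewrite -measure_le0 -A0; apply: le_measure; rewrite ?inE//.
  exact: measurableI.
have [h [h0 hfin hint hE]] := radon_nikodym_sigma_finite nu_dom.
exists (fine \o h); have hh : EFin \o (fine \o h) = h.
  by apply/funext => x /=; rewrite fineK.
split; first by rewrite hh.
move=> x ax xb; rewrite /Rintegral.
under eq_integral do rewrite fineK//.
rewrite -hE; last exact: measurable_itv.
rewrite /nu/= /mfrestr/= /mrestr setIidl; last exact: subset_itvl.
by rewrite stieltjes_itv.
Unshelve. all: by end_near. Qed.

End stieltjes.

(** * Completed Lebesgue measure and the fundamental theorem of calculus *)

Section completed_lebesgue.
Context {R : realType}.
Implicit Types (D N : set R) (f g h : R -> R) (F G : R -> \bar R).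

Local Notation leb := (@lebesgue_measure R).
Local Notation mu := (@lmu R).
Local Notation bT := (measurableTypeR R).
Local Notation cT := (caratheodory_type (R := R) (@mu_ext _ _ R (@wlength R idfun))).

Global Instance lmu_ae_filter : Filter (almost_everywhere mu).
Proof. exact: (ae_filter_ringOfSetsType (@completed_lebesgue_measure R)). Qed.

Lemma lmu_measurable D : measurable (D : set bT) -> measurable (D : set cT).
Proof. exact: sub_caratheodory. Qed.

Lemma lmu_itv (i : interval R) : measurable ([set` i] : set cT).
Proof. by apply: lmu_measurable; exact: measurable_itv. Qed.

Lemma lmu_measurable_fun D F : measurable (D : set bT) ->
  measurable_fun D F -> @measurable_fun _ _ cT _ D F.
Proof. by move=> mD mF _ Y mY; apply: lmu_measurable; exact: mF. Qed.

(** The Borel measure is the pushforward of its completion under the identity, which is measurable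
    from the larger sigma-algebra to the smaller. *)
Lemma ge0_integral_lmu D F : measurable (D : set bT) ->
  measurable_fun D F -> (forall x, D x -> (0 <= F x)%E) ->
  (\int[mu]_(x in D) F x = \int[leb]_(x in D) F x)%E.
Proof.
move=> mD mF F0.
have mid : measurable_fun [set: cT] (id : cT -> bT).
  by move=> _ Y mY; rewrite setTI; exact: lmu_measurable.
by rewrite -(@ge0_integral_pushforward _ _ _ _ _ _ mid mu D F)// => y /set_mem; exact: F0.
Qed.

Lemma integrable_lmu D F : measurable (D : set bT) ->
  leb.-integrable D F -> mu.-integrable D F.
Proof.
move=> mD /integrableP[mF iF]; apply/integrableP; split.
  exact: lmu_measurable_fun.
by rewrite ge0_integral_lmu//; exact: measurableT_comp.
Qed.

Lemma integral_lmu D F : measurable (D : set bT) ->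
  leb.-integrable D F -> (\int[mu]_(x in D) F x = \int[leb]_(x in D) F x)%E.
Proof.
move=> mD /integrableP[mF iF]; rewrite integralE [RHS]integralE.
rewrite !ge0_integral_lmu//; [exact: measurable_funeneg|exact: measurable_funepos].
Qed.

Lemma negligible_lmu N : leb.-negligible N -> mu.-negligible N.
Proof. by move=> [B [mB B0 NB]]; exists B; split => //; exact: lmu_measurable. Qed.

Lemma ae_lmu (P : R -> Prop) : {ae leb, forall x, P x} -> {ae mu, forall x, P x}.
Proof. exact: negligible_lmu. Qed.

Lemma lmu_ae_neq (x : R) : {ae mu, forall t, t != x}.
Proof.
rewrite /prop_near1 /nbhs/= /almost_everywhere.
rewrite (_ : ~` _ = [set x]); last first.
  by apply/seteqP; split => t /= => [/negP|->]; rewrite ?eqxx// negbK => /eqP.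
by apply: negligible_lmu; exists [set x]; split => //; exact: lebesgue_measure_set1.
Qed.

(** Completeness makes [g] measurable whatever it does on the exceptional null set. This is how
    [derive1 f], arbitrary where [f] is not differentiable, becomes integrable. *)
Lemma ae_integrable D f g : measurable (D : set cT) ->
  {ae mu, forall x, D x -> f x = g x} ->
  mu.-integrable D (EFin \o f) -> mu.-integrable D (EFin \o g).
Proof.
move=> mD fg /integrableP[mf intf].
have fg' : ae_eq mu D (EFin \o f) (EFin \o g).
  by apply: filterS fg => x /= h /h ->.
have mg : @measurable_fun _ _ cT _ D (EFin \o g).
  exact: (ae_measurable_fun (mu := @completed_lebesgue_measure R) completed_lebesgue_measure_is_complete fg' mf).
apply/integrableP; split => //; apply: le_lt_trans intf.
rewrite le_eqVlt; apply/orP; left; apply/eqP.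
apply: ae_eq_integral; [exact: mD|exact: measurableT_comp|exact: measurableT_comp|].
by apply: filterS fg => x /= h /h ->.
Qed.

Lemma ae_Rintegral D f g : measurable (D : set cT) ->
  {ae mu, forall x, D x -> f x = g x} ->
  mu.-integrable D (EFin \o f) ->
  \int[mu]_(x in D) f x = \int[mu]_(x in D) g x.
Proof.
move=> mD fg intf; have intg := ae_integrable mD fg intf.
have mf : @measurable_fun _ _ cT _ D (EFin \o f) by case/integrableP : intf.
have mg : @measurable_fun _ _ cT _ D (EFin \o g) by case/integrableP : intg.
congr fine; apply: (ae_eq_integral _ _ mD mf mg).
by apply: filterS fg => x /= h /h ->.
Qed.

(** Composing with [clamp a b] extends a function on [[a, b]] by its end values; a Stieltjes measure
    needs a function on the whole line. *)
Definition clamp (a b x : R) : R := Num.max a (Num.min b x).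

Lemma clampE a b x : a <= x -> x <= b -> clamp a b x = x.
Proof. by move=> ax xb; rewrite /clamp min_r// max_r. Qed.

Lemma clamp_ge a b x : a <= clamp a b x.
Proof. by rewrite /clamp le_max lexx. Qed.

Lemma clamp_le a b x : a <= b -> clamp a b x <= b.
Proof. by move=> ab; rewrite /clamp ge_max ab ge_min lexx. Qed.

Lemma clamp_homo a b x y : x <= y -> clamp a b x <= clamp a b y.
Proof.
move=> xy; rewrite /clamp ge_max !le_max lexx/=; apply/orP; right.
by rewrite le_min !ge_min lexx xy !orbT.
Qed.

Lemma clampB a b x y : x <= y -> clamp a b y - clamp a b x <= y - x.
Proof.
move=> xy; rewrite /clamp !minEle; do 2 (case: ifPn; rewrite -?ltNge => ?); rewrite !maxEle;
  do ? (case: ifPn; rewrite -?ltNge => ?); lra.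
Qed.

(** Clamping is monotone and 1-Lipschitz: it sends an ordered family to an ordered family inside
    [[a, b]] that is no longer. *)
Lemma ac_clamp a b f : a <= b -> ac a b f ->
  forall e : R, 0 < e -> exists2 d : R, 0 < d & forall lo hi s,
    ordered_in lo hi s -> incr id s < d -> incr (f \o clamp a b) s < e.
Proof.
move=> ab acf e /acf[d d0 H]; exists d => // lo hi s so sd.
pose t := [seq (clamp a b c.1, clamp a b c.2) | c <- s].
have -> : incr (f \o clamp a b) s = incr f t by rewrite /incr big_map.
apply: H.
  apply: (@ordered_inW _ (clamp a b lo) (clamp a b hi)); rewrite ?clamp_ge ?clamp_le//.
  rewrite /t; elim: s lo so {t sd} => /= [|p s IH] lo; first exact: clamp_homo.
  by move=> /and3P[h1 h2 /IH ->]; rewrite !clamp_homo.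
apply: le_lt_trans sd; rewrite /incr big_map.
elim: s lo so {t} => /= [|p s IH] lo; first by rewrite !big_nil.
move=> /and3P[h1 h2 /IH h]; rewrite !big_cons lerD//= !ger0_norm ?subr_ge0 ?clamp_homo//.
exact: clampB.
Qed.

Lemma ac_density a b f : a <= b -> ac a b f -> exists h,
  leb.-integrable setT (EFin \o h) /\
  forall x, a <= x -> x <= b -> f x - f a = \int[leb]_(t in `]a, x]) h t.
Proof.
move=> ab acf; pose V := variation_fun a f.
have acV : ac a b V by exact: variation_fun_ac.
have acVf : ac a b (fun x => V x - f x) by exact: acB.
have ndV : {homo V \o clamp a b : x y / x <= y}.
  move=> x y xy /=; rewrite -subr_ge0.
  apply: le_trans (variation_fun_ge acf (clamp_ge _ _ _) (clamp_homo _ _ xy) (clamp_le _ ab)).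
  exact: normr_ge0.
have ndVf : {homo (fun x => V x - f x) \o clamp a b : x y / x <= y}.
  move=> x y xy /=.
  have := variation_fun_ge acf (clamp_ge _ _ _) (clamp_homo _ _ xy) (clamp_le _ ab).
  by move=> /(le_trans (ler_norm _)); rewrite -/V; lra.
have [h1 [i1 e1]] := stieltjes_density ab ndV (ac_clamp ab acV).
have [h2 [i2 e2]] := stieltjes_density ab ndVf (ac_clamp ab acVf).
exists (fun x => h1 x - h2 x); split.
  rewrite (_ : EFin \o _ = (EFin \o h1) \- (EFin \o h2))%E; first exact: integrableB.
  by apply/funext => x /=; rewrite EFinB.
move=> x ax xb; have mx : measurable (`]a, x]%classic : set bT) by exact: measurable_itv.
rewrite RintegralB//; try by [apply: integrableS i1|apply: integrableS i2].
by rewrite -e1// -e2//= !clampE//; ring.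
Qed.

Lemma derivable_is_derive f (x : R) : derivable f x 1 -> is_derive x 1 f (derive1 f x).
Proof. by move=> df; rewrite derive1E; exact: derivableP. Qed.

Lemma near_derive1D f g (x r : R) : (\near x, f x + r = g x) -> derivable f x 1 ->
  derivable g x 1 /\ derive1 g x = derive1 f x.
Proof.
move=> fg /derivable_is_derive df.
have dfr := is_deriveD df (is_derive_cst r x 1).
have [dg gE] : is_derive x 1 g (derive1 f x + 0) := near_eq_is_derive fg dfr.
by split; [exact: dg|rewrite derive1E gE addr0].
Qed.

(** The integral formula is given for the Borel density [h], since [derive1 f] is not yet known to
    be integrable; [ac_derive_integrable] and [ac_FTC] put the derivative in its place. *)
Lemma ac_derive_density a b f : a <= b -> ac a b f -> exists h,
  [/\ leb.-integrable setT (EFin \o h),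
   {ae mu, forall t, a < t < b -> derivable f t 1 /\ derive1 f t = h t} &
   forall x y, a <= x -> x <= y -> y <= b -> f y - f x = \int[mu]_(t in `[x, y]) h t].
Proof.
move=> ab acf; have [h [ih eh]] := ac_density ab acf; exists h; split => //.
  have /FTC1 : forall y, leb.-integrable [set` Interval (BRight a) (BRight y)] (EFin \o h).
    by move=> y; apply: integrableS ih => //; exact: measurable_itv.
  move=> /(_ (open_integrable_locally openT ih)) /ae_lmu.
  apply: filterS => /= t H /andP[at_ tb].
  have [dF FE] := H at_.
  have nearF : \near t, \int[leb]_(u in [set` Interval (BRight a) (BRight t)]) h u + f a = f t.
    near=> u; rewrite -eh ?subrK//.
      by apply: ltW; near: u; exact: lt_nbhsr.
    by apply: ltW; near: u; exact: lt_nbhsl.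
  by have [df ->] := near_derive1D nearF dF.
move=> x y ax xy yb.
have ix : leb.-integrable `[x, y] (EFin \o h) by apply: integrableS ih => //; exact: measurable_itv.
have ixo : leb.-integrable `]x, y] (EFin \o h) by apply: integrableS ih => //; exact: measurable_itv.
have iay : leb.-integrable `]a, y] (EFin \o h) by apply: integrableS ih => //; exact: measurable_itv.
have -> : \int[mu]_(t in `[x, y]) h t = \int[leb]_(t in `[x, y]) h t.
  congr fine; apply: integral_lmu => //; exact: measurable_itv.
rewrite -Rintegral_itv_obnd_cbnd// -(@Rintegral_itvB _ _ (BRight a))//.
rewrite -!eh//; [by ring|exact: le_trans yb|exact: le_trans xy].
Unshelve. all: by end_near. Qed.

Lemma ac_ae_derivable a b f : a <= b -> ac a b f ->
  {ae mu, forall t, a < t < b -> derivable f t 1}.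
Proof.
move=> ab acf; have [h [_ H _]] := ac_derive_density ab acf.
by apply: filterS H => t H /H[].
Qed.

Lemma ac_ae_eq_density a b f h :
  {ae mu, forall t, a < t < b -> derivable f t 1 /\ derive1 f t = h t} ->
  forall x y, a <= x -> y <= b -> {ae mu, forall t, `[x, y]%classic t -> h t = derive1 f t}.
Proof.
move=> H x y ax yb.
apply: filterS3 H (lmu_ae_neq a) (lmu_ae_neq b) => t /= H ta tb; rewrite in_itv/= => /andP[xt ty].
by have [|_ ->] := H; rewrite // !lt_neqAle eq_sym ta tb (le_trans ax)//= (le_trans ty).
Qed.

Lemma ac_derive_integrable a b f : a <= b -> ac a b f ->
  mu.-integrable `[a, b] (EFin \o derive1 f).
Proof.
move=> ab acf; have [h [ih H _]] := ac_derive_density ab acf.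
apply: (@ae_integrable _ h); first exact: lmu_itv.
  exact: (ac_ae_eq_density H).
apply: integrable_lmu; first exact: measurable_itv.
by apply: integrableS ih => //; exact: measurable_itv.
Qed.

Lemma ac_FTC a b f : a <= b -> ac a b f ->
  \int[mu]_(t in `[a, b]) derive1 f t = f b - f a.
Proof.
move=> ab acf; have [h [ih H E]] := ac_derive_density ab acf.
rewrite E//; apply/esym; apply: ae_Rintegral; first exact: lmu_itv.
  exact: (ac_ae_eq_density H).
apply: integrable_lmu; first exact: measurable_itv.
by apply: integrableS ih => //; exact: measurable_itv.
Qed.

End completed_lebesgue.

(** * Functions with vanishing integrals, continuous weights, C1 functions *)

Section completed_lebesgue_integral.
Context {R : realType}.
Implicit Types (a b x y z : R) (f g h k : R -> R).

Local Notation leb := (@lebesgue_measure R).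
Local Notation mu := (@lmu R).
Local Notation bT := (measurableTypeR R).
Local Notation cT := (caratheodory_type (R := R) (@mu_ext _ _ R (@wlength R idfun))).

Lemma integral_lmu_obnd_cbnd x y (g : R -> \bar R) :
  mu.-integrable `[x, y] g ->
  (\int[mu]_(t in `]x, y]) g t = \int[mu]_(t in `[x, y]) g t)%E.
Proof.
move=> ig.
have mx : measurable ([set x] : set cT) by apply: lmu_measurable; exact: measurable_set1.
rewrite (negligible_integral mx (lmu_itv `[x, y]) ig); last exact: lebesgue_measure_set1.
congr integral; apply/seteqP; split => t /=; rewrite !in_itv/=.
  by move=> /andP[xt ->]; rewrite (ltW xt); split => // tx; rewrite tx ltxx in xt.
by move=> [/andP[xt ->] /eqP tx]; rewrite lt_neqAle xt eq_sym tx.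
Qed.

Lemma Rintegral_lmu_cat x y z g : x <= y -> y <= z ->
  mu.-integrable `[x, z] (EFin \o g) ->
  \int[mu]_(t in `[x, z]) g t = \int[mu]_(t in `[x, y]) g t + \int[mu]_(t in `[y, z]) g t.
Proof.
move=> xy yz ig.
have iyz : mu.-integrable `[y, z] (EFin \o g).
  by apply: integrableS ig; [exact: lmu_itv|exact: lmu_itv|apply: subset_itvr; rewrite bnd_simp].
have E : `[x, z]%classic = `[x, y]%classic `|` `]y, z]%classic.
  by rewrite -itv_bndbnd_setU// bnd_simp.
rewrite E Rintegral_setU; [|exact: lmu_itv|exact: lmu_itv|by rewrite -E|].
  by congr (_ + _); congr fine; exact: integral_lmu_obnd_cbnd.
apply/disj_set2P; apply/seteqP; split => t //=; rewrite !in_itv/=.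
by move=> [/andP[_ ty] /andP[yt _]]; rewrite ltNge ty in yt.
Qed.

(** The vanishing spreads from intervals to Borel sets by the Dynkin argument, and from these to
    Lebesgue measurable sets by approximation from outside; a function whose integral vanishes over
    all measurable subsets is zero almost everywhere. *)
Lemma Rintegral0_ae0 a b g : a <= b -> mu.-integrable `[a, b] (EFin \o g) ->
  (forall x y, a <= x -> x <= y -> y <= b -> \int[mu]_(t in `[x, y]) g t = 0) ->
  {ae mu, forall t, `[a, b]%classic t -> g t = 0}.
Proof.
(* Half-open intervals are stable under intersection with the generators of the Borel sets; the
   point [a] is restored at the end as a null set. *)
move=> ab ig H; pose D := `]a, b]%classic.
have mD : measurable (D : set cT) by exact: lmu_itv.
have igS (A : set cT) : measurable A -> mu.-integrable (A `&` D) (EFin \o g).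
  move=> mA; apply: integrableS ig; [exact: lmu_itv|exact: measurableI|].
  by move=> t [_ /=]; rewrite /D/= !in_itv/= => /andP[/ltW-> ->].
have mgS (A : set cT) : measurable A -> @measurable_fun _ _ cT _ (A `&` D) (EFin \o g).
  by move=> mA; case/integrableP : (igS _ mA).
have sub x y : a <= x -> x <= y -> y <= b -> mu.-integrable `[x, y] (EFin \o g).
  move=> ax xy yb; apply: integrableS ig; [exact: lmu_itv|exact: lmu_itv|].
  by apply: subset_itv; rewrite bnd_simp.
have H0 x y : a <= x -> y <= b -> (\int[mu]_(t in `]x, y]) (g t)%:E = 0)%E.
  move=> ax yb; have [xy|yx] := leP x y; last first.
    by rewrite set_itv_ge ?integral_set0// bnd_simp -leNgt ltW.
  rewrite integral_lmu_obnd_cbnd; last exact: sub.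
  rewrite -[LHS]fineK; last by apply: integrable_fin_num; [exact: lmu_itv|exact: sub].
  by congr EFin; exact: H.
have borel (A : set bT) : measurable A -> (\int[mu]_(t in A `&` D) (g t)%:E = 0)%E.
  apply: (@dynkin_induction _ bT (@measurable _ (ocitv_type R))
    (fun A1 => \int[mu]_(t in A1 `&` D) (g t)%:E = 0)%E) => //.
  - by move=> A1 A2 mA1 mA2; exact: measurableI.
  - by rewrite setTI; exact: H0.
  - move=> A1 /ocitvP[->|[[p q] /= pq ->]]; first by rewrite set0I integral_set0.
    rewrite (_ : _ `&` D = `]Num.max p a, Num.min q b]%classic).
      by rewrite H0// ?le_max ?ge_min lexx orbT.
    apply/seteqP; split => t /=; rewrite /D/= !in_itv/= gt_max le_min.
      by move=> [/andP[-> ->] /andP[-> ->]].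
    by move=> /andP[/andP[-> ->] /andP[-> ->]].
  - move=> A1 mA1 A10; have mA' := lmu_measurable mA1.
    suff : (\int[mu]_(t in (A1 `&` D) `|` (~` A1 `&` D)) (g t)%:E = 0)%E.
      rewrite integral_setU; last 4 first.
      - exact: measurableI.
      - by apply: measurableI => //; exact: measurableC.
      - by rewrite -setIUl setUv; exact: (mgS setT).
      - by apply/disj_set2P; rewrite setIACA setICr set0I.
      by rewrite A10 add0e.
    by rewrite -setIUl setUv setTI; exact: H0.
  - move=> F mF tF F0; rewrite setI_bigcupl.
    have mF' n : measurable (F n `&` D : set cT).
      by apply: measurableI => //; exact: lmu_measurable.
    rewrite integral_bigcup//; last 2 first.
    + exact: trivIset_setIr.
    + rewrite -setI_bigcupl; apply: igS.
      by apply: bigcupT_measurable => n; exact: lmu_measurable.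
    by rewrite eseries0.
have key : ae_eq mu D (EFin \o g) (cst 0%E).
  apply: integral_ae_eq => //.
    by have := igS _ (@measurableT _ cT); rewrite setTI.
  move=> E ED mE; rewrite integral0.
  (* The Gdelta hull of [E] has the same measure as [E], which is finite because [E] lies in [D], so
     that hull and [E] differ by a null set. *)
  have [G [oG EG GE]] := outer_measure_Gdelta E.
  pose B := \bigcap_i G i.
  have mB : measurable (B : set bT).
    by apply: bigcap_measurable => [|i _]; [exists 0%N|exact: open_measurable].
  have mB' := lmu_measurable mB.
  have muE : (mu E < +oo)%E.
    apply: (@le_lt_trans _ _ (mu D)); first by apply: le_measure; rewrite ?inE.
    rewrite (_ : mu D = leb D)// lebesgue_measure_itv/=; case: ifPn => _; rewrite ?ltry//.
  have muBE0 : mu (B `\` E) = 0%E.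
    have -> : mu (B `\` E) = (mu B - mu (B `&` E))%E.
      by apply: measureD => //; apply: le_lt_trans muE; rewrite (_ : mu E = mu B).
    rewrite setIidr// (_ : mu B = mu E)// subee//.
    by rewrite ge0_fin_numE.
  have BE0 : mu ((B `&` D) `\` E) = 0%E.
    apply: (subset_measure0 (mu := @completed_lebesgue_measure R) _ _ _ muBE0).
    - by apply: measurableD => //; exact: measurableI.
    - exact: measurableD.
    - by move=> t [[]].
  have mBD : measurable (B `&` D : set cT) by exact: measurableI.
  have mBDE : measurable ((B `&` D) `\` E : set cT) by exact: measurableD.
  have := negligible_integral mBDE mBD (igS _ mB') BE0.
  rewrite borel// setDD setIidr; first by move=> <-.
  by move=> t Et; split; [exact: EG|exact: ED].
apply: filterS2 key (lmu_ae_neq a) => t /= Ht ta; rewrite in_itv/= => /andP[at_ tb].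
have /Ht[] // : D t.
by rewrite /D/= in_itv/= lt_neqAle eq_sym ta at_ tb.
Qed.

Lemma continuous_lmu_integrable a b k : {within `[a, b], continuous k} ->
  mu.-integrable `[a, b] (EFin \o k).
Proof.
move=> ck; apply: integrable_lmu; first exact: measurable_itv.
by apply: continuous_compact_integrable => //; exact: segment_compact.
Qed.

Lemma continuous_bounded a b k : {within `[a, b], continuous k} ->
  exists M, forall x, `[a, b]%classic x -> `|k x| <= M.
Proof.
move=> ck; have := compact_bounded (continuous_compact ck (@segment_compact _ a b)).
move=> [M [_ HM]]; exists (M + 1) => x xab; apply: (HM (M + 1)); rewrite ?ltrDl//.
Qed.

Lemma integrableM_continuous a b g k : {within `[a, b], continuous k} ->
  mu.-integrable `[a, b] (EFin \o g) -> mu.-integrable `[a, b] (EFin \o (fun t => g t * k t)).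
Proof.
move=> ck ig.
have mk : @measurable_fun _ _ cT _ `[a, b] k.
  by apply/measurable_EFinP; case/integrableP : (continuous_lmu_integrable ck).
have [M HM] := continuous_bounded ck.
rewrite (_ : EFin \o _ = (EFin \o g) \* (EFin \o k))%E; last first.
  by apply/funext => t; rewrite /= EFinM.
apply: integrableMl => //; first exact: lmu_itv.
exists M; split; first exact: num_real.
by move=> N MN t /HM /le_trans; apply; exact: ltW.
Qed.

Lemma C1_ac a b k (k1 : R -> R) :
  (forall x, a <= x -> x <= b -> is_derive x 1 k (k1 x)) ->
  {within `[a, b], continuous k1} -> ac a b k.
Proof.
move=> dk ck1; have [M HM] := continuous_bounded ck1.
apply: (@ac_lipschitz _ _ _ _ M) => x y ax xy yb.
have dxy t : t \in `[x, y] -> is_derive t 1 k (k1 t).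
  by rewrite in_itv/= => /andP[xt ty]; apply: dk; [exact: le_trans xt|exact: le_trans yb].
have dxyo t : t \in `]x, y[ -> is_derive t 1 k (k1 t).
  by move=> txy; apply: dxy; exact: subset_itv_oo_cc txy.
have cxyk : {within `[x, y], continuous k}.
  by apply: derivable_within_continuous => t /dxy [].
have [c cxy kc] := MVT_segment xy dxyo cxyk.
rewrite kc.
rewrite normrM ler_wpM2r// HM//=; move: cxy; rewrite !in_itv/= => /andP[xc cy].
by rewrite (le_trans ax)//= (le_trans cy).
Qed.

Lemma ac_continuous a b k : ac a b k -> {within `[a, b], continuous k}.
Proof.
move=> ack; apply/subspace_continuousP => x; rewrite /= in_itv/= => /andP[ax xb].
apply/cvgrPdist_lt => e /ack[d d0 H].
rewrite /prop_near1 /nbhs/= /within/=; exists d => //= y; rewrite /ball/= in_itv/= => xy /andP[ay yb].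
have H' p r : a <= p -> p <= r -> r <= b -> `|r - p| < d -> `|k r - k p| < e.
  by move=> ap pr rb; have := H [:: (p, r)]; rewrite /= ap pr rb /incr !big_seq1; exact.
by have [lexy|/ltW leyx] := leP x y; [rewrite distrC H'// distrC|exact: H'].
Qed.

End completed_lebesgue_integral.

(** * The filter at [x0] and exhaustion of the interval *)

Section endpoint_filter.
Context {R : realType}.
Implicit Types (T M x : R) (P : set R).

(** One description covers a finite and an infinite endpoint, so that nothing after this section
    distinguishes them. Taking [M] at least [T] keeps the points considered inside the domain. *)
Lemma to_x0P (x0 : \bar R) T P : (T%:E < x0)%E ->
  to_x0 x0 P <-> exists M, [/\ T <= M, (M%:E < x0)%E &
    forall x, M < x -> (x%:E < x0)%E -> P x].
Proof.
case: x0 => [r| |]//= Tr; split.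
- move=> [e /= e0 H]; exists (Num.max T (r - e)); split.
  + by rewrite le_max lexx.
  + by rewrite lte_fin gt_max -lte_fin Tr/= ltrBlDr ltrDl.
  + move=> x; rewrite gt_max lte_fin => /andP[_ rx] xr; apply: H => //=.
    by rewrite gtr0_norm ?subr_gt0// ltrBlDr addrC -ltrBlDr.
- move=> [M [_ Mr H]]; exists (r - M) => /=; first by rewrite subr_gt0 -lte_fin.
  move=> x /= + xr; rewrite gtr0_norm ?subr_gt0// ltrD2l ltrN2 => Mx.
  exact: H.
- move=> [M [_ H]]; exists (Num.max T M); split; [by rewrite le_max lexx|exact: ltry|].
  by move=> x; rewrite gt_max => /andP[_ /H].
- move=> [M [_ _ H]]; exists M; split; first exact: num_real.
  by move=> x Mx; apply: H => //; exact: ltry.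
Qed.

Lemma ex_between (x0 : \bar R) T : (T%:E < x0)%E -> exists2 x, T < x & (x%:E < x0)%E.
Proof.
case: x0 => [r| |]//=; first rewrite lte_fin => Tr.
  by exists ((T + r) / 2); rewrite ?lte_fin; lra.
by move=> _; exists (T + 1); rewrite ?ltrDl// ltry.
Qed.

Lemma to_x0_proper (x0 : \bar R) T : (T%:E < x0)%E -> ProperFilter (to_x0 x0).
Proof.
by case: x0 => [r _|_|//]; [exact: (at_left_proper_filter r)|exact: proper_pinfty_nbhs].
Qed.

Lemma near_to_x0 (x0 : \bar R) T : (T%:E < x0)%E ->
  \forall x \near to_x0 x0, T < x /\ (x%:E < x0)%E.
Proof. by move=> Tx; apply/(to_x0P _ Tx); exists T; split. Qed.

Lemma ex_exhaustion (x0 : \bar R) T : (T%:E < x0)%E ->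
  exists2 b : nat -> R, (forall n, (b n)%:E < x0)%E &
    forall t, (t%:E < x0)%E -> exists n, t < b n.
Proof.
case: x0 => [r| |]//= cr.
  exists (fun n => r - n.+1%:R^-1).
    by move=> n; rewrite lte_fin ltrBlDr ltrDl.
  move=> t; rewrite lte_fin => tr; have rt : 0 < r - t by rewrite subr_gt0.
  exists (Num.truncn (r - t)^-1); rewrite ltrBrDl -ltrBrDr.
  by rewrite invf_plt ?posrE// truncnS_gt.
exists (fun n => n%:R) => [n|t _]; first exact: ltry.
by exists (Num.truncn t).+1; exact: truncnS_gt.
Qed.

(** Results on bounded intervals are glued along a sequence exhausting the domain towards [x0]:
    countably many null sets and the point [T] are discarded. *)
Lemma ae_Iset (x0 : \bar R) T P : (T%:E < x0)%E ->
  (forall b, T <= b -> (b%:E < x0)%E ->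
    {ae @lmu R, forall t, T < t < b -> P t}) ->
  {ae @lmu R, forall t, Iset T x0 t -> P t}.
Proof.
move=> Tx0 H; have [b bI bE] := ex_exhaustion Tx0.
have Hn n : {ae @lmu R, forall t, T < t < b n -> P t}.
  have [Tb|bT] := leP T (b n); first exact: H (bI n).
  apply: aeW => t /andP[Tt tb]; move: (lt_trans Tt tb).
  by rewrite ltNge (ltW bT).
apply: filterS2 (ae_foralln Hn) (lmu_ae_neq T) => t /= Ht tT [Tt tx0].
have [n tn] := bE _ tx0; apply: (Ht n).
by rewrite lt_neqAle eq_sym tT Tt.
Qed.

(** The same gluing towards the left end, for properties reached only on [[c, x0)] with [c > T]
    because [Phi] vanishes at [T]. *)
Lemma ae_Iset_gt (x0 : \bar R) T P :
  (forall c, T < c -> (c%:E < x0)%E ->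
    {ae @lmu R, forall t, Iset c x0 t -> P t}) ->
  {ae @lmu R, forall t, Iset T x0 t -> P t}.
Proof.
move=> H; pose c n := T + n.+1%:R^-1.
have Hn n : {ae @lmu R, forall t, Iset (c n) x0 t -> P t}.
  have Tc : T < c n by rewrite ltrDl.
  have [cx|xc] := ltP (c n)%:E x0; first exact: H.
  apply: aeW => t [ct tx]; have : ((c n)%:E < x0)%E by apply: le_lt_trans tx; rewrite lee_fin.
  by rewrite ltNge xc.
apply: filterS2 (ae_foralln Hn) (lmu_ae_neq T) => t /= Ht tT [Tt tx0].
have Tt' : 0 < t - T by rewrite subr_gt0 lt_neqAle eq_sym tT Tt.
apply: (Ht (Num.truncn (t - T)^-1)); split => //.
rewrite /c -lerBrDl ltW// invf_plt ?posrE//; exact: truncnS_gt.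
Qed.

End endpoint_filter.

(** * Linear combinations of integrable functions; difference quotients *)

Section real_helpers.
Context {R : realType}.
Local Notation mu := (@lmu R).

Lemma lmu_integrableB (i : interval R) (g h : R -> R) :
  mu.-integrable [set` i] (EFin \o g) -> mu.-integrable [set` i] (EFin \o h) ->
  mu.-integrable [set` i] (EFin \o (fun t => g t - h t)).
Proof.
move=> ig ih; have := integrableB (mu := @completed_lebesgue_measure R) (lmu_itv i) ig ih.
by apply: eq_integrable; [exact: lmu_itv|move=> t _ /=; rewrite EFinB].
Qed.

Lemma lmu_integrableZl (i : interval R) (r : R) (g : R -> R) :
  mu.-integrable [set` i] (EFin \o g) ->
  mu.-integrable [set` i] (EFin \o (fun t => r * g t)).
Proof.
move=> ig; have := integrableZl (mu := @completed_lebesgue_measure R) (lmu_itv i) r ig.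
by apply: eq_integrable; [exact: lmu_itv|move=> t _ /=; rewrite EFinM].
Qed.

Lemma is_derive_cvg (g : R -> R) (t d : R) : is_derive t 1 g d ->
  h^-1 * (g (h + t) - g t) @[h --> 0^'] --> d.
Proof.
move=> [dg <-]; move: dg; rewrite /derivable => dg.
rewrite /derive; move: dg.
rewrite (_ : (fun h : R => h^-1 *: _) = (fun h => h^-1 * (g (h + t) - g t))) //.
by apply/funext => h /=; rewrite [h *: _]mulr1.
Qed.

End real_helpers.

(* The situation common to the representations (vi) and (vii): off a null set
   g' = q * v', where v is C^1 and strictly monotone with the finite limit v0 at
   x0; with psi = phi1 (resp. Phi) one takes g = f / psi and q = fstar2 (resp. Fstar). *)
Record quotient_setup {R : realType} (x0 : \bar R) (c : R) (f g v v1 q : R -> R)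
    (v0 sg : R) : Prop := QuotientSetup {
  setup_lt : (c%:E < x0)%E ;
  setup_f : forall b, (b%:E < x0)%E -> ac c b f ;
  setup_g : forall b, (b%:E < x0)%E -> ac c b g ;
  setup_v : forall x, Iset c x0 x -> is_derive x 1 v (v1 x) ;
  setup_v1 : {within Iset c x0, continuous v1} ;
  setup_norm : `|sg| = 1 ;
  setup_sg : forall x, Iset c x0 x -> 0 < sg * v1 x ;
  setup_lim : v @ to_x0 x0 --> v0 ;
  setup_deriv : forall t, Iset c x0 t -> derivable f t 1 ->
    is_derive t 1 g (q t * v1 t) }.

(** * Consequences of a quotient setup *)

Section quotient_derivative.
Context {R : realType}.
Variables (x0 : \bar R) (c : R) (f g v v1 q : R -> R) (v0 sg : R).
Local Notation mu := (@lmu R).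
Let J := Iset c x0.
Hypothesis S : quotient_setup x0 c f g v v1 q v0 sg.

Let cx0 : (c%:E < x0)%E := setup_lt S.
Let f_ac b : (b%:E < x0)%E -> ac c b f. Proof. exact: (setup_f S). Qed.
Let g_ac b : (b%:E < x0)%E -> ac c b g. Proof. exact: (setup_g S). Qed.
Let v_deriv x : J x -> is_derive x 1 v (v1 x). Proof. exact: (setup_v S). Qed.
Let v1_cont : {within J, continuous v1} := setup_v1 S.
Let sg1 : `|sg| = 1 := setup_norm S.
Let v1_sg x : J x -> 0 < sg * v1 x. Proof. exact: (setup_sg S). Qed.
Let v_lim : v @ to_x0 x0 --> v0 := setup_lim S.
Let g_deriv t : J t -> derivable f t 1 -> is_derive t 1 g (q t * v1 t).
Proof. exact: (setup_deriv S). Qed.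

#[local] Instance to_x0_setup : ProperFilter (to_x0 x0).
Proof. exact: (to_x0_proper cx0). Qed.

Let v1_contS x y : c <= x -> (y%:E < x0)%E -> {within `[x, y], continuous v1}.
Proof.
move=> cx yx0; apply: continuous_subspaceW v1_cont => t /=.
rewrite in_itv/= => /andP[xt ty]; split; first exact: le_trans xt.
by apply: le_lt_trans yx0; rewrite lee_fin.
Qed.

Let inJ x y t : c <= x -> (y%:E < x0)%E -> `[x, y]%classic t -> J t.
Proof.
move=> cx yx0; rewrite /= in_itv/= => /andP[xt ty]; split; first exact: le_trans xt.
by apply: le_lt_trans yx0; rewrite lee_fin.
Qed.

Lemma ae_derivable : {ae mu, forall t, J t -> derivable f t 1}.
Proof.
apply: ae_Iset cx0 _ => b cb bx0; exact: ac_ae_derivable cb (f_ac bx0).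
Qed.

(** Every interval next to [x0] has positive measure, so it cannot consist of points where [f] is
    not differentiable. Uniqueness of the limits of the coefficients rests on this. *)
Lemma to_x0_D_proper : ProperFilter (to_x0_D x0 f).
Proof.
have FF : Filter (to_x0_D x0 f) by apply: within_filter; exact: filter_filter.
apply: Build_ProperFilter_ex => P /= /(to_x0P _ cx0)[M [cM Mx0 H]].
have [b Mb bx0] := ex_between Mx0.
have : ~ mu.-negligible `]M, b[.
  move=> [N [mN N0 MN]].
  have : (mu `]M, b[ <= mu N)%E by apply: le_measure; rewrite ?inE//; exact: lmu_itv.
  rewrite N0 (_ : mu `]M, b[ = (@lebesgue_measure R) `]M, b[)//.
  by rewrite lebesgue_measure_itv/= lte_fin Mb -EFinB lee_fin subr_le0 leNgt Mb.
move=> nneg; apply: contrapT => nP; apply: nneg.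
apply: negligibleS ae_derivable => t /=; rewrite in_itv/= => /andP[Mt tb] Ht.
have tx0 : (t%:E < x0)%E by apply: lt_trans bx0; rewrite lte_fin.
apply: nP; exists t; apply: H => //.
by apply: Ht; split => //; rewrite (le_trans cM)// ltW.
Qed.

Let v_ac x y : c <= x -> x <= y -> (y%:E < x0)%E -> ac x y v.
Proof.
move=> cx xy yx0; apply: (@C1_ac _ _ _ _ v1) => //; last exact: v1_contS.
by move=> t xt ty; apply: v_deriv; apply: (inJ cx yx0); rewrite /= in_itv/= xt.
Qed.

Let v1_int x y : c <= x -> (y%:E < x0)%E -> mu.-integrable `[x, y] (EFin \o v1).
Proof. by move=> cx yx0; apply: continuous_lmu_integrable; exact: v1_contS. Qed.

Let v1_FTC x y : c <= x -> x <= y -> (y%:E < x0)%E ->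
  \int[mu]_(t in `[x, y]) v1 t = v y - v x.
Proof.
move=> cx xy yx0; rewrite -ac_FTC//; last exact: v_ac.
apply: eq_Rintegral => t /set_mem /(inJ cx yx0) /v_deriv dv.
by rewrite derive1E derive_val.
Qed.

Let g1_ae x y : c <= x -> (y%:E < x0)%E ->
  {ae mu, forall t, `[x, y]%classic t -> derive1 g t = v1 t * q t}.
Proof.
move=> cx yx0; apply: filterS ae_derivable => t /= H /(inJ cx yx0) Jt.
have := g_deriv Jt (H Jt) => dg.
by rewrite derive1E derive_val mulrC.
Qed.

Lemma quotient_integrable x y : c <= x -> (y%:E < x0)%E ->
  mu.-integrable `[x, y] (EFin \o (fun t => v1 t * q t)).
Proof.
move=> cx yx0; have [xy|yx] := leP x y.
  apply: ae_integrable (g1_ae cx yx0) _; first exact: lmu_itv.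
  by apply: ac_derive_integrable => //; apply: acW (g_ac yx0).
rewrite set_itv_ge; last by rewrite bnd_simp -ltNge.
exact: integrable_set0.
Qed.

Lemma quotient_FTC x y : c <= x -> x <= y -> (y%:E < x0)%E ->
  \int[mu]_(t in `[x, y]) (v1 t * q t) = g y - g x.
Proof.
move=> cx xy yx0; have acg : ac x y g by apply: acW (g_ac yx0).
rewrite -ac_FTC//; apply/esym; apply: ae_Rintegral; first exact: lmu_itv.
  exact: g1_ae.
exact: ac_derive_integrable.
Qed.

(** The product [v1 * q] is integrable as a derivative, and the reciprocal of [v1] is continuous on
    the compact interval. *)
Lemma coef_integrable x y : c <= x -> (y%:E < x0)%E ->
  mu.-integrable `[x, y] (EFin \o q).
Proof.
move=> cx yx0.
have v1n0 t : `[x, y]%classic t -> v1 t != 0.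
  move=> /(inJ cx yx0)/v1_sg; apply: contraTN => /eqP ->.
  by rewrite mulr0 ltxx.
have : mu.-integrable `[x, y] (EFin \o (fun t => v1 t * q t * (v1 t)^-1)).
  apply: integrableM_continuous (quotient_integrable cx yx0).
  apply/subspace_continuousP => t xyt; apply: cvgV; first exact: v1n0.
  by move/subspace_continuousP : (v1_contS cx yx0); exact.
apply: eq_integrable; first exact: lmu_itv.
by move=> t /set_mem/v1n0 n0 /=; rewrite mulrAC mulfV// mul1r.
Qed.

(* sg * v1 is the absolute value of v1, so its integral is |v y - v x|. *)
Lemma weighted_integral_bound (k : R -> R) x y e : c <= x -> x <= y -> (y%:E < x0)%E ->
  0 <= e -> mu.-integrable `[x, y] (EFin \o (fun t => v1 t * k t)) ->
  (forall t, `[x, y]%classic t -> `|k t| <= e) ->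
  `|\int[mu]_(t in `[x, y]) (v1 t * k t)| <= e * `|v y - v x|.
Proof.
move=> cx xy yx0 e0 i2 ke.
apply: le_trans (le_normr_Rintegral (lmu_itv _) i2) _.
have i1 := v1_int cx yx0.
apply: (@le_trans _ _ (\int[mu]_(t in `[x, y]) (e * sg * v1 t))).
  apply: le_Rintegral; first exact: lmu_itv.
  - exact: (integrable_norm (mu := @completed_lebesgue_measure R) i2).
  - exact: lmu_integrableZl.
  move=> t xyt; have vt := v1_sg (inJ cx yx0 xyt).
  have -> : e * sg * v1 t = `|v1 t| * e.
    by rewrite -[`|v1 t|]mul1r -sg1 -normrM gtr0_norm//; ring.
  by rewrite normrM ler_wpM2l// ke.
rewrite RintegralZl//; last exact: lmu_itv.
by rewrite v1_FTC// -mulrA ler_wpM2l// (le_trans (ler_norm _))// normrM sg1 mul1r.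
Qed.

Section coefficient_limit.
Variable ga : R.
Let G x := g x - ga * v x.

Lemma remainder_integrable x y : c <= x -> (y%:E < x0)%E ->
  mu.-integrable `[x, y] (EFin \o (fun t => v1 t * (q t - ga))).
Proof.
move=> cx yx0.
have h : mu.-integrable `[x, y] (EFin \o (fun t => ga * v1 t)).
  by apply: lmu_integrableZl; exact: v1_int.
have := lmu_integrableB (quotient_integrable cx yx0) h.
by apply: eq_integrable; [exact: lmu_itv|move=> t _ /=; rewrite mulrBr (mulrC ga)].
Qed.

Lemma remainder_FTC x y : c <= x -> x <= y -> (y%:E < x0)%E ->
  \int[mu]_(t in `[x, y]) (v1 t * (q t - ga)) = G y - G x.
Proof.
move=> cx xy yx0.
have h : mu.-integrable `[x, y] (EFin \o (fun t => ga * v1 t)).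
  by apply: lmu_integrableZl; exact: v1_int.
transitivity (\int[mu]_(t in `[x, y]) (v1 t * q t - ga * v1 t)).
  by apply: eq_Rintegral => t _; rewrite mulrBr (mulrC ga).
rewrite RintegralB//; [|exact: lmu_itv|exact: quotient_integrable].
rewrite quotient_FTC// RintegralZl//; [|exact: lmu_itv|exact: v1_int].
by rewrite v1_FTC// /G; ring.
Qed.

Lemma remainder_bound M e : c <= M -> 0 <= e ->
  (forall t, M < t -> (t%:E < x0)%E -> derivable f t 1 -> `|q t - ga| <= e) ->
  forall x y, M < x -> x <= y -> (y%:E < x0)%E ->
    `|G y - G x| <= e * `|v y - v x|.
Proof.
move=> cM e0 H x y Mx xy yx0; have cx : c <= x by rewrite (le_trans cM)// ltW.
(* The bound on [q - ga] is known only where [f] is differentiable; setting the other values to 0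
   makes it hold everywhere without changing the integral. *)
pose q' t := if `[< derivable f t 1 >] then q t - ga else 0.
have qq' : {ae mu, forall t, `[x, y]%classic t -> v1 t * (q t - ga) = v1 t * q' t}.
  apply: filterS ae_derivable => t /= Ht /(inJ cx yx0)/Ht df.
  by rewrite /q' asboolT.
have i1 := remainder_integrable cx yx0.
have i2 := ae_integrable (lmu_itv _) qq' i1.
rewrite -remainder_FTC// (ae_Rintegral (lmu_itv _) qq' i1).
apply: weighted_integral_bound => // t xyt; rewrite /q'; case: asboolP => [df|_].
  apply: H => //; last exact: (inJ cx yx0 xyt).2.
  by move: xyt; rewrite /= in_itv/= => /andP[xt _]; exact: lt_le_trans xt.
by rewrite normr0.
Qed.

Lemma to_x0_D_cvgP (h : R -> R) l : h @ to_x0_D x0 f --> l <->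
  forall e : R, 0 < e -> exists M, [/\ c <= M, (M%:E < x0)%E &
    forall t, M < t -> (t%:E < x0)%E -> derivable f t 1 -> `|h t - l| <= e].
Proof.
have FF := to_x0_D_proper; split => [/cvgrPdist_le H e /H /(to_x0P _ cx0)[M [cM Mx0 {}H]]|H].
  by exists M; split => // t Mt tx0 df; rewrite distrC; exact: H.
apply/cvgrPdist_le => e /H[M [cM Mx0 {}H]]; apply/(to_x0P _ cx0); exists M; split => //.
by move=> t Mt tx0 df; rewrite distrC; exact: H.
Qed.

(** * From a limit of the coefficient to the remainder *)

Section necessity.
Hypothesis q_lim : q @ to_x0_D x0 f --> ga.

(** Once [q] is within 1 of [ga], increments of [G] are bounded by those of [v]; as [v] converges,
    [G] is Cauchy. *)
Lemma remainder_cvg : exists l : R, G @ to_x0 x0 --> l.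
Proof.
have [M [cM Mx0 H]] := (to_x0_D_cvgP _ _).1 q_lim _ ltr01.
suff cG : cvg (G @ to_x0 x0) by exists (lim (G @ to_x0 x0)).
have FG : ProperFilter (G @ to_x0 x0) by exact: fmap_proper_filter.
apply: cauchy_cvg; apply: cauchy_exP => e e0.
have /cvgrPdist_lt/(_ (e / 2)) : v @ to_x0 x0 --> v0 by [].
rewrite divr_gt0// => /(_ isT) /(to_x0P _ Mx0)[N [MN Nx0 HN]].
have [z Nz zx0] := ex_between Nx0.
exists (G z); apply/(to_x0P _ zx0); exists z; split => // y zy yx0.
rewrite /ball/= distrC (le_lt_trans (remainder_bound cM ler01 H _ (ltW zy) yx0))//.
  exact: le_lt_trans Nz.
have h1 := HN _ Nz zx0; have h2 := HN _ (lt_trans Nz zy) yx0.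
rewrite mul1r (splitr e) (_ : v y - v z = (v0 - v z) - (v0 - v y)); last ring.
by rewrite (le_lt_trans (ler_normB _ _))// ltrD.
Qed.

(** The increment bound between [x] and [y] is passed to the limit in [y]. With [v := u], whose
    limit is 0, it yields the error term o(phi2). *)
Lemma remainder_small l : G @ to_x0 x0 --> l -> forall e : R, 0 < e ->
  \forall x \near to_x0 x0, `|l - G x| <= e * `|v0 - v x|.
Proof.
move=> Gl e e0.
have [M [cM Mx0 H]] := (to_x0_D_cvgP _ _).1 q_lim _ e0.
apply/(to_x0P _ cx0); exists M; split => // x Mx xx0.
apply: (@ler_cvg_to _ (to_x0 x0) _ _ (fun y => `|G y - G x|) (fun y => e * `|v y - v x|)).
- by apply: cvg_norm; apply: cvgB => //; exact: cvg_cst.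
- by apply: cvgMr; apply: cvg_norm; apply: cvgB => //; exact: cvg_cst.
- apply/(to_x0P _ xx0); exists x; split => // y xy yx0.
  by apply: remainder_bound H _ _ _ _ _ => //; exact: ltW.
Qed.

Lemma quotient_cvg l : G @ to_x0 x0 --> l -> g @ to_x0 x0 --> l + ga * v0.
Proof.
move=> Gl; rewrite (_ : g = fun x => G x + ga * v x).
  by apply: cvgD => //; exact: cvgMr.
by apply/funext => x; rewrite /G subrK.
Qed.

Lemma remainder_imp_int l x : G @ to_x0 x0 --> l -> J x ->
  imp_int x0 (fun t => v1 t * (q t - ga)) x (l - G x).
Proof.
move=> Gl [cx xx0]; split; first by move=> b; exact: remainder_integrable.
suff : (fun b => G b - G x) @ to_x0 x0 --> l - G x.
  apply: cvg_trans; apply: near_eq_cvg; apply/(to_x0P _ xx0); exists x; split => // b xb bx0.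
  by rewrite remainder_FTC// ltW.
by apply: cvgB => //; exact: cvg_cst.
Qed.

Lemma quotient_imp_int l x : g @ to_x0 x0 --> l -> J x ->
  imp_int x0 (fun t => v1 t * q t) x (l - g x).
Proof.
move=> gl [cx xx0]; split; first by move=> b; exact: quotient_integrable.
suff : (fun b => g b - g x) @ to_x0 x0 --> l - g x.
  apply: cvg_trans; apply: near_eq_cvg; apply/(to_x0P _ xx0); exists x; split => // b xb bx0.
  by rewrite quotient_FTC// ltW.
by apply: cvgB => //; exact: cvg_cst.
Qed.

End necessity.

Lemma imp_int_cat (h : R -> R) x y L L' : J x -> x <= y -> (y%:E < x0)%E ->
  imp_int x0 h x L -> imp_int x0 h y L' -> L = \int[mu]_(t in `[x, y]) h t + L'.
Proof.
move=> Jx xy yx0 [ix cx_] [iy cy].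
suff cx' : (fun b => \int[mu]_(t in `[x, b]) h t) @ to_x0 x0
    --> \int[mu]_(t in `[x, y]) h t + L'.
  exact: cvg_unique cx_ cx'.
suff : (fun b => \int[mu]_(t in `[x, y]) h t + \int[mu]_(t in `[y, b]) h t) @ to_x0 x0
    --> \int[mu]_(t in `[x, y]) h t + L'.
  apply: cvg_trans; apply: near_eq_cvg; apply/(to_x0P _ yx0); exists y; split => // b yb bx0.
  by rewrite (Rintegral_lmu_cat xy (ltW yb))//; exact: ix.
by apply: cvgD => //; exact: cvg_cst.
Qed.

(** * From an integral representation to the limit of the coefficient *)

Section sufficiency.
Variables (F : R -> R) (A : R).
Hypothesis F_small : little_o (to_x0 x0) F (fun=> 1).
Hypothesis F_rep : forall x, J x -> exists L,
  imp_int x0 (fun t => v1 t * F t) x L /\ g x = A + ga * v x - L.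

Lemma rep_increment x y : J x -> x <= y -> (y%:E < x0)%E ->
  mu.-integrable `[x, y] (EFin \o (fun t => v1 t * F t)) /\
  \int[mu]_(t in `[x, y]) (v1 t * F t) = G y - G x.
Proof.
move=> Jx xy yx0; have Jy : J y by case: Jx => cx _; split; first exact: le_trans xy.
have [L [IL gx]] := F_rep Jx; have [L' [IL' gy]] := F_rep Jy.
split; first by case: IL => + _; exact.
by rewrite /G gx gy (imp_int_cat Jx xy yx0 IL IL'); ring.
Qed.

Lemma rep_bound M e : c <= M -> 0 <= e ->
  (forall t, M < t -> (t%:E < x0)%E -> `|F t| <= e) ->
  forall x y, M < x -> x <= y -> (y%:E < x0)%E ->
    `|G y - G x| <= e * `|v y - v x|.
Proof.
move=> cM e0 H x y Mx xy yx0; have cx : c <= x by rewrite (le_trans cM)// ltW.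
have Jx : J x by split => //; apply: le_lt_trans yx0; rewrite lee_fin.
have [i2 <-] := rep_increment Jx xy yx0.
apply: weighted_integral_bound => // t xyt.
apply: H; last exact: (inJ cx yx0 xyt).2.
by move: xyt; rewrite /= in_itv/= => /andP[xt _]; exact: lt_le_trans xt.
Qed.

(** Seen from a fixed point [b], [G] is [A - L] plus an indefinite integral tending to [L]. Hence
    the constant of the representation is forced. *)
Lemma rep_remainder_cvg : G @ to_x0 x0 --> A.
Proof.
have [b cb bx0] := ex_between cx0.
have Jb : J b by split => //; exact: ltW.
have [L [IL gb]] := F_rep Jb.
have GE y : b <= y -> (y%:E < x0)%E -> G y = (A - L) + \int[mu]_(t in `[b, y]) (v1 t * F t).
  by move=> bY yx0; rewrite (rep_increment Jb bY yx0).2 /G gb; ring.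
rewrite -[X in _ --> X](subrK L).
suff : (fun y => A - L + \int[mu]_(t in `[b, y]) (v1 t * F t)) @ to_x0 x0 --> A - L + L.
  apply: cvg_trans; apply: near_eq_cvg; apply/(to_x0P _ bx0); exists b; split => // y bY yx0.
  by rewrite GE// ltW.
by apply: cvgD; [exact: cvg_cst|case: IL].
Qed.

(** Equality of [F] and [q - ga] almost everywhere would not suffice, since the limit concerns every
    point of differentiability. The increment bound holds between any two points near [x0], and
    dividing it by [h] and letting [h] tend to 0 bounds [q t - ga] at each such [t]. *)
Lemma rep_coef_lim : q @ to_x0_D x0 f --> ga.
Proof.
apply/to_x0_D_cvgP => e e0.
have /(to_x0P _ cx0)[M [cM Mx0 H]] := F_small e0.
exists M; split => // t Mt tx0 df.
have Jt : J t by split => //; rewrite (le_trans cM)// ltW.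
have dG : is_derive t 1 G (q t * v1 t - ga * v1 t).
  by have dg := g_deriv Jt df; have dv := v_deriv Jt; rewrite /G; apply: is_deriveB.
have v1t : 0 < `|v1 t|.
  by rewrite normr_gt0; apply: contraTN (v1_sg Jt) => /eqP ->; rewrite mulr0 ltxx.
suff : `|q t * v1 t - ga * v1 t| <= e * `|v1 t|.
  by rewrite -mulrBl normrM ler_pM2r.
have HF s : M < s -> (s%:E < x0)%E -> `|F s| <= e.
  by move=> Ms sx0; have := H _ Ms sx0; rewrite normr1 mulr1.
have dvt := v_deriv Jt.
have lG := is_derive_cvg dG; have lv := is_derive_cvg dvt.
apply: (@ler_cvg_to _ ((0 : R)^') _ _ (fun h => `|h^-1 * (G (h + t) - G t)|)
   (fun h => e * `|h^-1 * (v (h + t) - v t)|)).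
- exact: cvg_norm.
- by apply: cvgMr; exact: cvg_norm.
have [b tb bx0] := ex_between tx0.
near=> h.
rewrite !normrM mulrCA ler_wpM2l//.
have Mh : M < h + t.
  rewrite -ltrBlDr; near: h; apply: nbhs_dnbhs; apply: lt_nbhsr; rewrite subr_lt0//.
have hx0 : ((h + t)%:E < x0)%E.
  apply: lt_trans bx0; rewrite lte_fin -ltrBrDr; near: h; apply: nbhs_dnbhs; apply: lt_nbhsl.
  by rewrite subr_gt0.
have [h0|h0] := leP 0 h.
  by apply: rep_bound HF _ _ _ _ _ => //; [exact: ltW|rewrite lerDr].
rewrite distrC [X in _ <= _ * X]distrC.
by apply: rep_bound HF _ _ _ _ _ => //; [exact: ltW|rewrite gerDr ltW].
Unshelve. all: by end_near. Qed.

(** Both [v1 * F] and [v1 * (q - ga)] integrate to the increment of [G] over every subinterval, so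
    they agree almost everywhere, and [v1] has no zero. *)
Lemma rep_unique : {ae mu, forall t, J t -> F t = q t - ga}.
Proof.
apply: ae_Iset cx0 _ => b cb bx0.
have Jc : J c by [].
have i1 := (rep_increment Jc cb bx0).1.
have i2 := remainder_integrable (lexx c) bx0.
have sub x y (h : R -> R) : c <= x -> y <= b -> mu.-integrable `[c, b] (EFin \o h) ->
    mu.-integrable `[x, y] (EFin \o h).
  move=> cx yb; apply: integrableS; [exact: lmu_itv|exact: lmu_itv|].
  by apply: subset_itv; rewrite bnd_simp.
have key : {ae mu, forall t, `[c, b]%classic t -> v1 t * F t - v1 t * (q t - ga) = 0}.
  apply: Rintegral0_ae0 (lmu_integrableB i1 i2) _ => // x y cx xy yb; have yx0 : (y%:E < x0)%E by apply: le_lt_trans bx0; rewrite lee_fin.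
  have Jx : J x by split => //; apply: le_lt_trans yx0; rewrite lee_fin.
  rewrite RintegralB; [|exact: lmu_itv|exact: sub|exact: sub].
  by rewrite (rep_increment Jx xy yx0).2 remainder_FTC// subrr.
apply: filterS key => t /= Ht /andP[ct tb].
have Jt : J t by split; [exact: ltW|apply: lt_trans bx0; rewrite lte_fin].
have v1n0 : v1 t != 0.
  by apply: contraTN (v1_sg Jt) => /eqP ->; rewrite mulr0 ltxx.
have : v1 t * F t - v1 t * (q t - ga) = 0 by apply: Ht; rewrite in_itv/= (ltW ct) ltW.
by move=> /eqP; rewrite subr_eq0 => /eqP; exact: mulfI.
Qed.

End sufficiency.

End coefficient_limit.
End quotient_derivative.

(** * Derivatives of quotients and functions of constant sign *)

Section calculus.
Context {R : realType}.
Implicit Types (f g h : R -> R).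

Lemma is_derive_div f g (x f' g' : R) : g x != 0 ->
  is_derive x 1 f f' -> is_derive x 1 g g' ->
  is_derive x 1 (fun y => f y / g y) ((f' * g x - f x * g') / g x ^+ 2).
Proof.
move=> g0 df dg; apply: (is_derive_eq (is_deriveM df (is_deriveV g0 dg))).
by rewrite /GRing.scale/=; field.
Qed.

Lemma is_derive_within_cvg f (x d : R) (A : set R) : is_derive x 1 f d ->
  f @ within A (nbhs x) --> f x.
Proof.
move=> [df _]; apply: cvg_within_filter.
by apply: differentiable_continuous; apply/derivable1_diffP.
Qed.

Lemma within_constant_sign (x0 : \bar R) T f :
  {within Iset T x0, continuous f} -> (forall x, Iset T x0 x -> f x != 0) ->
  exists sg : R, `|sg| = 1 /\ forall x, Iset T x0 x -> 0 < sg * f x.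
Proof.
move=> cf f0; have [Tx0|x0T] := ltP T%:E x0; last first.
  exists 1; split; first exact: normr1.
  by move=> x [Tx xx0]; move: (lt_le_trans xx0 x0T); rewrite lte_fin ltNge Tx.
have fT0 : f T != 0 by apply: f0; split.
exists (Num.sg (f T)); split; first by rewrite normr_sg fT0.
move=> x [Tx xx0].
rewrite ltNge; apply/negP => fx.
have [| |c] := @IVT R f T x 0 Tx.
- apply: continuous_subspaceW cf => t /=; rewrite in_itv/= => /andP[Tt tx].
  by split => //; apply: le_lt_trans xx0; rewrite lee_fin.
- move: fx; case: (ltrgtP (f T) 0) fT0 => // fT _.
    rewrite ltr0_sg// mulN1r oppr_le0 => fx.
    by rewrite ge_min le_max (ltW fT) fx orbT.
  rewrite gtr0_sg// mul1r => fx.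
  by rewrite ge_min le_max (ltW fT) fx orbT.
rewrite in_itv/= => /andP[Tc cx] fc.
have /f0 : Iset T x0 c by split => //; apply: le_lt_trans xx0; rewrite lee_fin.
by rewrite fc eqxx.
Qed.

Lemma inv_ac (a b : R) h (h1 : R -> R) :
  (forall x, a <= x -> x <= b -> is_derive x 1 h (h1 x)) ->
  {within `[a, b], continuous h1} ->
  (forall x, a <= x -> x <= b -> h x != 0) ->
  ac a b (fun x => (h x)^-1).
Proof.
move=> dh ch1 h0; apply: (@C1_ac _ _ _ _ (fun x => - h x ^- 2 *: h1 x)).
  by move=> x ax xb; apply: is_deriveV; [exact: h0|exact: dh].
apply/subspace_continuousP => x xab.
have /andP[ax xb] : a <= x <= b by move: xab; rewrite /= in_itv.
have ch := is_derive_within_cvg `[a, b]%classic (dh _ ax xb).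
apply: cvgM; last by move/subspace_continuousP : ch1; exact.
apply: cvgN; apply: cvgV; first by rewrite expf_neq0// h0.
by rewrite expr2; under eq_fun do rewrite expr2; exact: cvgM.
Qed.

End calculus.

(** * The two quotient setups attached to [phi1] and [Phi] *)

Section expansions.
Context {R : realType}.
Variables (x0 : \bar R) (T : R) (phi1 phi2 f : R -> R).
Hypotheses (hTx0 : (T%:E < x0)%E)
  (hC1 : C1_on T x0 phi1) (hC2 : C1_on T x0 phi2)
  (ho21 : little_o (to_x0 x0) phi2 phi1)
  (hphi1 : forall x, Iset T x0 x -> phi1 x != 0)
  (hphi2 : forall x, Iset T x0 x -> phi2 x != 0)
  (hW : forall x, Iset T x0 x -> Wr phi1 phi2 x != 0)
  (hf : AC_on T x0 f).
Local Notation mu := (@lmu R).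
Local Notation I := (Iset T x0).
Local Notation W := (Wr phi1 phi2).
Local Notation f1s := (fstar1 phi1 phi2 f).
Local Notation f2s := (fstar2 phi1 phi2 f).
Local Notation Fs := (Fstar T phi1 phi2 f).
Local Notation P := (Phi T phi1 phi2).
Local Notation fx0 := (to_x0_D x0 f).
Implicit Types (a b l ga t : R).
Let u y := phi2 y / phi1 y.
(** The factor [phi1 T] normalizes the derivative to [W / P ^+ 2]. The antiderivative built on
    [phi2] instead, [phi2 / (phi2 T * P)], is smaller by the constant [(phi1 T * phi2 T)^-1] and
    tends to 0, whence the limit of [v]. *)
Let v y := phi1 y / (phi1 T * P y).

#[local] Instance to_x0_filter : ProperFilter (to_x0 x0).
Proof. exact: (to_x0_proper hTx0). Qed.

Let f_ac b : (b%:E < x0)%E -> ac T b f.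
Proof. by move=> bx0; apply: abs_cont_on_ac; exact: hf. Qed.

#[local] Instance to_x0_D_filter : Filter fx0.
Proof. by apply: within_filter; exact: filter_filter. Qed.

Let IT : I T. Proof. by split. Qed.

Let subI c x : T <= c -> Iset c x0 x -> I x.
Proof. by move=> Tc [cx xx0]; split => //; exact: le_trans cx. Qed.

Let near_I (Q : R -> Prop) : (forall t, I t -> Q t) -> \forall t \near to_x0 x0, Q t.
Proof.
move=> H; apply/(to_x0P _ hTx0); exists T; split => // t Tt tx0.
by apply: H; split => //; exact: ltW.
Qed.

Let near_D (Q : R -> Prop) : (forall t, I t -> derivable f t 1 -> Q t) -> \forall t \near fx0, Q t.
Proof. by move=> H; apply: near_I => t It Dt; exact: H. Qed.

Let cvg_D (h : R -> R) (l : R) : h @ to_x0 x0 --> l -> h @ fx0 --> l.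
Proof. exact: cvg_within_filter. Qed.

Let eq_cvg_I (h k : R -> R) (l : R) : (forall t, I t -> h t = k t) ->
  h @ to_x0 x0 --> l -> k @ to_x0 x0 --> l.
Proof. by move=> hk; apply: cvg_trans; apply: near_eq_cvg; apply: near_I => t /hk. Qed.

Let eq_cvg_D (h k : R -> R) (l : R) : (forall t, I t -> derivable f t 1 -> h t = k t) ->
  h @ fx0 --> l -> k @ fx0 --> l.
Proof. by move=> hk; apply: cvg_trans; apply: near_eq_cvg; apply: near_D => t It /hk ->. Qed.

Let d1 x : I x -> is_derive x 1 phi1 (derive1 phi1 x).
Proof. by move=> Ix; apply: derivable_is_derive; apply: (hC1.1). Qed.

Let d2 x : I x -> is_derive x 1 phi2 (derive1 phi2 x).
Proof. by move=> Ix; apply: derivable_is_derive; apply: (hC2.1). Qed.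

Let c1 x : I x -> phi1 @ within I (nbhs x) --> phi1 x.
Proof. by move=> /d1; exact: is_derive_within_cvg. Qed.

Let c2 x : I x -> phi2 @ within I (nbhs x) --> phi2 x.
Proof. by move=> /d2; exact: is_derive_within_cvg. Qed.

Let c1' x : I x -> derive1 phi1 @ within I (nbhs x) --> derive1 phi1 x.
Proof. by move: x; apply/subspace_continuousP; exact: (hC1.2). Qed.

Let c2' x : I x -> derive1 phi2 @ within I (nbhs x) --> derive1 phi2 x.
Proof. by move: x; apply/subspace_continuousP; exact: (hC2.2). Qed.

Let cW x : I x -> W @ within I (nbhs x) --> W x.
Proof.
by move=> Ix; apply: cvgB; apply: cvgM;
  [exact: c1|exact: c2'|exact: c1'|exact: c2].
Qed.

Lemma Wr_sign : exists sg : R, `|sg| = 1 /\ forall x, I x -> 0 < sg * W x.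
Proof. by apply: within_constant_sign => //; apply/subspace_continuousP => x; exact: cW. Qed.

Let u_deriv x : I x -> is_derive x 1 u (W x / phi1 x ^+ 2).
Proof.
move=> Ix; apply: (is_derive_eq (is_derive_div (hphi1 Ix) (d2 Ix) (d1 Ix))).
by congr (_ / _); rewrite /Wr; ring.
Qed.

Let u1E x : I x -> derive1 u x = W x / phi1 x ^+ 2.
Proof. by move=> /u_deriv du; rewrite derive1E derive_val. Qed.

Let u1_cont : {within I, continuous (derive1 u)}.
Proof.
apply: (@subspace_eq_continuous _ _ _ (fun x => W x / phi1 x ^+ 2)).
  by move=> x /set_mem Ix; exact/esym/u1E.
apply/subspace_continuousP => x Ix; apply: cvgM; first exact: cW.
apply: cvgV; first by rewrite expf_neq0// hphi1.
rewrite expr2; under eq_fun do rewrite expr2; by apply: cvgM; exact: c1.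
Qed.

Let u_lim : u @ to_x0 x0 --> 0.
Proof.
apply/cvgrPdist_le => e e0; near=> x.
have Ix : I x by near: x; exact: near_I.
rewrite sub0r normrN /u normrM normfV ler_pdivrMr ?normr_gt0 ?hphi1//.
by near: x; exact: ho21.
Unshelve. all: by end_near. Qed.

Let inv_phi1_ac c b : T <= c -> (b%:E < x0)%E -> ac c b (fun x => (phi1 x)^-1).
Proof.
move=> Tc bx0.
have inI x : c <= x -> x <= b -> I x.
  by move=> cx xb; split; [exact: le_trans cx|apply: le_lt_trans bx0; rewrite lee_fin].
apply: (@inv_ac _ _ _ _ (derive1 phi1)).
- by move=> x cx xb; apply: d1; exact: inI.
- apply: continuous_subspaceW hC1.2 => x /=; rewrite in_itv/= => /andP[]; exact: inI.
- by move=> x cx xb; apply: hphi1; exact: inI.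
Qed.

Let g_is_derive t : I t -> derivable f t 1 ->
  is_derive t 1 (fun y => f y / phi1 y) (f2s t * derive1 u t).
Proof.
move=> It /derivable_is_derive df.
apply: (is_derive_eq (is_derive_div (hphi1 It) df (d1 It))).
rewrite u1E// /fstar2; move: (hW It) (hphi1 It); set w := W t => w0 p0.
by rewrite /Wr; field; rewrite w0 p0.
Qed.

Lemma setup_phi1 : exists2 sg : R, (forall x, I x -> 0 < sg * W x) &
  quotient_setup x0 T f (fun y => f y / phi1 y) u (derive1 u) f2s 0 sg.
Proof.
have [sg [sg1 sgW]] := Wr_sign; exists sg; [exact: sgW|split].
- exact: hTx0.
- by move=> b; exact: f_ac.
- by move=> b bx0; apply: acM; [exact: f_ac|exact: inv_phi1_ac].
- by move=> x Ix; rewrite u1E//; exact: u_deriv.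
- exact: u1_cont.
- exact: sg1.
- move=> x Ix; rewrite u1E// mulrA divr_gt0 ?sgW//.
  by rewrite exprn_even_gt0//= hphi1.
- exact: u_lim.
- exact: g_is_derive.
Qed.

#[local] Instance to_x0_D_properfilter : ProperFilter fx0.
Proof. by have [sg _ S] := setup_phi1; exact: to_x0_D_proper S. Qed.

Let PE x : I x -> P x = phi1 x * phi1 T * (u T - u x).
Proof.
move=> Ix; rewrite /Phi /u; field.
by rewrite !hphi1.
Qed.

(** Since [P x] is [phi1 x * phi1 T] times [u T - u x], a zero beyond [T] would contradict the mean
    value theorem: the derivative [W / phi1 ^+ 2] of [u] never vanishes. *)
Lemma Phi_neq0 x : I x -> T < x -> P x != 0.
Proof.
move=> Ix Tx; rewrite PE// !mulf_neq0 ?hphi1//.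
have inI t : t \in `[T, x] -> I t.
  rewrite in_itv/= => /andP[Tt tx]; split => //.
  by apply: le_lt_trans Ix.2; rewrite lee_fin.
have du t : t \in `]T, x[ -> is_derive t 1 u (W t / phi1 t ^+ 2).
  by move=> tTx; apply: u_deriv; apply: inI; exact: subset_itv_oo_cc tTx.
have cu : {within `[T, x], continuous u}.
  by apply: derivable_within_continuous => t /inI/u_deriv[].
have [c cTx uc] := MVT_segment (ltW Tx) du cu.
rewrite -opprB oppr_eq0 uc !mulf_neq0 ?invr_eq0 ?expf_neq0 ?hW ?hphi1//; try exact: inI.
by rewrite subr_eq0 gt_eqF.
Qed.

Let dP x : I x -> is_derive x 1 P (phi2 T * derive1 phi1 x - phi1 T * derive1 phi2 x).
Proof.
move=> Ix; have h1 := d1 Ix; have h2 := d2 Ix.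
exact: (is_deriveB (is_deriveZ (phi2 T) h1) (is_deriveZ (phi1 T) h2)).
Qed.

Let v_deriv x : I x -> T < x -> is_derive x 1 v (W x / P x ^+ 2).
Proof.
move=> Ix Tx; have P0 := Phi_neq0 Ix Tx; have T0 := hphi1 IT.
have PT0 : phi1 T * P x != 0 by rewrite mulf_neq0.
have dTP : is_derive x 1 (fun y => phi1 T * P y) (phi1 T * (phi2 T * derive1 phi1 x - phi1 T * derive1 phi2 x)).
  exact: (is_deriveZ (phi1 T) (dP Ix)).
have dv : is_derive x 1 v _ := is_derive_div (g := fun y => phi1 T * P y) PT0 (d1 Ix) dTP.
apply: (is_derive_eq dv); move: P0; rewrite /Wr; set p := P x => P0.
have -> : (derive1 phi1 x * (phi1 T * p) - phi1 x * (phi1 T * (phi2 T * derive1 phi1 x - phi1 T * derive1 phi2 x)))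
  = phi1 T ^+ 2 * (phi1 x * derive1 phi2 x - derive1 phi1 x * phi2 x).
  by rewrite /p /Phi; ring.
by field; rewrite P0.
Qed.

Let Pphi1_lim : (fun x => P x / phi1 x) @ to_x0 x0 --> phi2 T.
Proof.
apply: (@eq_cvg_I (fun x => phi2 T - phi1 T * u x)).
  by move=> t It; rewrite /Phi /u; field; exact: hphi1.
have : (fun x => phi2 T - phi1 T * u x) @ to_x0 x0 --> phi2 T - phi1 T * 0.
  by apply: cvgB; [exact: cvg_cst|exact: cvgMr].
by rewrite mulr0 subr0.
Qed.

Let v_lim : v @ to_x0 x0 --> (phi1 T * phi2 T)^-1.
Proof.
apply: (@eq_cvg_I (fun x => (phi1 T * (P x / phi1 x))^-1)).
  by move=> t It; rewrite /v; rewrite !invfM !invrK; ring.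
apply: cvgV; first by rewrite mulf_neq0 ?hphi1 ?hphi2.
exact: cvgMr.
Qed.

(** The base point [c] lies beyond [T], where [P] is zero, and is left free so that it can be taken
    as close to [T] as wanted. *)
Lemma setup_Phi sg c : `|sg| = 1 -> (forall x, I x -> 0 < sg * W x) ->
  T < c -> (c%:E < x0)%E ->
  quotient_setup x0 c f (fun y => f y / P y) v (fun x => W x / P x ^+ 2) Fs
    (phi1 T * phi2 T)^-1 sg.
Proof.
move=> sg1 sgW Tc cx0.
have inI x : Iset c x0 x -> I x by apply: subI; exact: ltW.
have P0 x : Iset c x0 x -> P x != 0.
  by move=> Jx; apply: Phi_neq0; [exact: inI|exact: lt_le_trans Jx.1].
have cP x : Iset c x0 x -> P @ within (Iset c x0) (nbhs x) --> P x.
  by move=> /inI /dP; exact: is_derive_within_cvg.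
have subJ : Iset c x0 `<=` I by [].
have wc (h : R -> R) x : h @ within I (nbhs x) --> h x -> h @ within (Iset c x0) (nbhs x) --> h x.
  move=> H A /H; rewrite /nbhs/= /fmap/= /within/=.
  by apply: filterS => t Ht Jt; apply: Ht; exact: inI.
split; first exact: cx0.
- by move=> b bx0; apply: acW (f_ac bx0) => //; exact: ltW.
- move=> b bx0; have inJ x : c <= x -> x <= b -> Iset c x0 x.
    by move=> cx xb; split => //; apply: le_lt_trans bx0; rewrite lee_fin.
  apply: acM; first by apply: acW (f_ac bx0) => //; exact: ltW.
  apply: (@inv_ac _ _ _ _ (fun x => phi2 T * derive1 phi1 x - phi1 T * derive1 phi2 x)).
  + by move=> x cx xb; apply: dP; apply: inI; exact: inJ.
  + have sI : `[c, b]%classic `<=` I.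
      by move=> x /=; rewrite in_itv/= => /andP[cx xb]; apply: inI; exact: inJ.
    apply: (continuous_subspaceW sI); apply/subspace_continuousP => x Ix.
    by apply: cvgB; apply: cvgMr; [exact: c1'|exact: c2'].
  + by move=> x cx xb; apply: P0; exact: inJ.
- by move=> x Jx; apply: v_deriv; [exact: inI|exact: lt_le_trans Jx.1].
- apply/subspace_continuousP => x Jx; apply: cvgM; first by apply: wc; apply: cW; exact: inI.
  apply: cvgV; first by rewrite expf_neq0// P0.
  by rewrite expr2; under eq_fun do rewrite expr2; apply: cvgM; exact: cP.
- exact: sg1.
- move=> x Jx; rewrite mulrA divr_gt0 ?sgW//; first exact: inI.
  by rewrite exprn_even_gt0//= P0.
- exact: v_lim.
- move=> t Jt /derivable_is_derive df; have It := inI _ Jt.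
  apply: (is_derive_eq (is_derive_div (P0 _ Jt) df (dP It))).
  move: (hW It) (P0 _ Jt) => w0 p0.
  have -> : Fs t = (P t * derive1 f t - (phi2 T * derive1 phi1 t - phi1 T * derive1 phi2 t) * f t) / W t.
    rewrite /Fstar /fstar1 /fstar2; move: w0; set w := W t => w0.
    by rewrite /Wr /Phi; field.
  by field; rewrite ?p0 ?w0.
Qed.

(** * Relations between the coefficients and between their limits *)

Lemma fstar1E t : I t -> f1s t = f t / phi1 t - f2s t * u t.
Proof.
move=> It; have w0 := hW It; have p0 := hphi1 It.
rewrite /fstar1 /fstar2 /u; rewrite /Wr in w0 *; field.
by rewrite w0 p0.
Qed.

Lemma FstarE t : I t -> Fs t = phi1 T * (f t / phi1 t) + f2s t * (phi2 T - phi1 T * u t).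
Proof. by move=> It; rewrite /Fstar fstar1E//; ring. Qed.

Lemma fstar2E t : I t -> T < t ->
  f2s t = phi1 t / P t * Fs t - phi1 T * (f t / P t).
Proof.
move=> It Tt; have P0 := Phi_neq0 It Tt; have p0 := hphi1 It.
rewrite FstarE// /u.
have -> : phi2 T - phi1 T * (phi2 t / phi1 t) = P t / phi1 t by rewrite /Phi; field.
by field; rewrite P0 p0.
Qed.

(** The hub of all equivalences. Because [u] tends to 0, the second clause amounts to [f / phi1]
    tending to [a1]; it is written as the remainder of the [phi1] setup, the form in which the
    results on that setup produce and consume it. *)
Definition limits a1 a2 : Prop :=
  f2s @ fx0 --> a2 /\ (fun x => f x / phi1 x - a2 * u x) @ to_x0 x0 --> a1.

Lemma limits_exist a2 : f2s @ fx0 --> a2 -> exists a1, limits a1 a2.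
Proof.
move=> h2; have [sg _ S] := setup_phi1.
by have [a1 h1] := remainder_cvg S h2; exists a1.
Qed.

Lemma limits_fphi1 a1 a2 : limits a1 a2 -> (fun x => f x / phi1 x) @ to_x0 x0 --> a1.
Proof.
move=> [h2 h1]; have [sg _ S] := setup_phi1.
by have := quotient_cvg S h1; rewrite mulr0 addr0.
Qed.

Lemma limits_fstar1 a1 a2 : limits a1 a2 -> f1s @ fx0 --> a1.
Proof.
move=> Q; apply: (@eq_cvg_D (fun t => f t / phi1 t - f2s t * u t)).
  by move=> t It _; rewrite fstar1E.
rewrite -[X in _ --> X]subr0 -(mulr0 a2); apply: cvgB.
  by apply: cvg_D; exact: limits_fphi1 Q.
by apply: cvgM; [exact: Q.1|exact: cvg_D].
Qed.

Lemma limits_Fstar a1 a2 : limits a1 a2 -> Fs @ fx0 --> a1 * phi1 T + a2 * phi2 T.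
Proof.
move=> Q; rewrite (mulrC a1) (mulrC a2); apply: cvgD; apply: cvgMr.
  exact: limits_fstar1 Q.
exact: Q.1.
Qed.

Lemma limits_unique a1 a2 b1 b2 : limits a1 a2 -> limits b1 b2 -> b1 = a1 /\ b2 = a2.
Proof.
move=> Qa Qb; split.
  exact: cvg_unique (limits_fphi1 Qb) (limits_fphi1 Qa).
exact: cvg_unique Qb.1 Qa.1.
Qed.

(** By [fstar2E], [f2s] is [phi1 / P * Fs - phi1 T * (f / P)]. Here [phi1 / P] tends to
    [(phi2 T)^-1] and [f / P] to [l + ga / (phi1 T * phi2 T)]; the contributions of [ga] cancel. *)
Lemma Fstar_cvg ga : Fs @ fx0 --> ga -> exists l : R,
  (fun x => f x / P x - ga * v x) @ to_x0 x0 --> l /\ f2s @ fx0 --> - (phi1 T * l).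
Proof.
move=> hF; have [sg [sg1 sgW]] := Wr_sign; have [c Tc cx0] := ex_between hTx0.
have S := setup_Phi sg1 sgW Tc cx0.
have [l hl] := remainder_cvg S hF; exists l; split => //.
have T0 := hphi1 IT; have T2 := hphi2 IT.
have -> : - (phi1 T * l) = (phi2 T)^-1 * ga - phi1 T * (l + ga * (phi1 T * phi2 T)^-1).
  by field; rewrite T0 T2.
have H : (fun t => phi1 t / P t * Fs t - phi1 T * (f t / P t)) @ fx0 -->
    (phi2 T)^-1 * ga - phi1 T * (l + ga * (phi1 T * phi2 T)^-1).
  apply: cvgB; last by apply: cvgMr; apply: cvg_D; have := quotient_cvg S hl.
  apply: cvgM => //; apply: cvg_D.
  rewrite (_ : (fun t => _) = (fun t => (P t / phi1 t)^-1)).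
    exact: cvgV Pphi1_lim.
  by apply/funext => t; rewrite invf_div.
apply: cvg_trans H; apply: near_eq_cvg.
have : \forall t \near fx0, T < t /\ (t%:E < x0)%E.
  by apply: filterS (near_to_x0 hTx0) => t.
apply: filterS => t [Tt tx0]; rewrite fstar2E//; split => //; exact: ltW.
Qed.

Lemma limits_of_i ga : Fs @ fx0 --> ga -> exists a1 a2, limits a1 a2.
Proof.
by move=> /Fstar_cvg[l [_ /limits_exist[a1 Q]]]; exists a1, (- (phi1 T * l)).
Qed.

(** The limit [l] of the remainder exists by [Fstar_cvg] and satisfies [a2 = - (phi1 T * l)] by
    uniqueness of the limit of [f2s]. *)
Lemma limits_remainder_Phi a1 a2 : limits a1 a2 ->
  (fun x => f x / P x - (a1 * phi1 T + a2 * phi2 T) * v x) @ to_x0 x0 --> - (a2 / phi1 T).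
Proof.
move=> Q; have [l [hl h2]] := Fstar_cvg (limits_Fstar Q).
have -> // : - (a2 / phi1 T) = l.
rewrite -(cvg_unique (@Rhausdorff R) h2 Q.1); field; exact: hphi1.
Qed.

(** * Asymptotic expansions, undifferentiated and differentiated *)

Lemma expansionP b1 b2 :
  little_o (to_x0 x0) (fun x => f x - (b1 * phi1 x + b2 * phi2 x)) phi2 <->
  forall e : R, 0 < e -> \forall x \near to_x0 x0, `|b1 - (f x / phi1 x - b2 * u x)| <= e * `|u x|.
Proof.
(* Division by [phi1 x] gives the estimate the shape of [remainder_small] for the [phi1] setup. *)
have E x e : I x -> (`|f x - (b1 * phi1 x + b2 * phi2 x)| <= e * `|phi2 x|) =
    (`|b1 - (f x / phi1 x - b2 * u x)| <= e * `|u x|).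
  move=> Ix; have p0 := hphi1 Ix.
  have -> : f x - (b1 * phi1 x + b2 * phi2 x) = - (phi1 x * (b1 - (f x / phi1 x - b2 * u x))).
    by rewrite /u; field.
  have -> : phi2 x = phi1 x * u x by rewrite /u; field.
  by rewrite normrN (normrM (phi1 x)) (normrM (phi1 x)) (mulrCA e) ler_pM2l// normr_gt0.
split=> H e /H; apply: filter_app; apply: near_I => x Ix; rewrite E//.
Qed.

Lemma limits_expansion a1 a2 : limits a1 a2 ->
  little_o (to_x0 x0) (fun x => f x - (a1 * phi1 x + a2 * phi2 x)) phi2.
Proof.
move=> [h2 h1]; apply/expansionP => e e0; have [sg _ S] := setup_phi1.
by have := remainder_small S h2 h1 e0; under eq_near do rewrite sub0r normrN.
Qed.

Lemma expansion_cvg b1 b2 :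
  little_o (to_x0 x0) (fun x => f x - (b1 * phi1 x + b2 * phi2 x)) phi2 ->
  (fun x => f x / phi1 x - b2 * u x) @ to_x0 x0 --> b1.
Proof.
move=> /expansionP/(_ 1 ltr01) H; apply/cvgrPdist_le => e e0.
near=> x; apply: (@le_trans _ _ (1 * `|u x|)); first by near: x; exact: H.
rewrite mul1r -normrN -sub0r; near: x.
by move: e e0; apply/cvgrPdist_le; exact: u_lim.
Unshelve. all: by end_near. Qed.

Let u1_neq0 t : I t -> derive1 u t != 0.
Proof. by move=> It; rewrite u1E// mulf_neq0 ?hW// invr_eq0 expf_neq0// hphi1. Qed.

(** Where [f] is differentiable, the derivative of [f / phi1] is [f2s] times that of [u], which has
    no zero and can be divided out. *)
Lemma iv_second b2 :
  little_o fx0 (fun x => derive1 (fun y => f y / phi1 y) x - b2 * derive1 (fun y => phi2 y / phi1 y) x)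
    (derive1 (fun y => phi2 y / phi1 y)) <-> f2s @ fx0 --> b2.
Proof.
have E t e : I t -> derivable f t 1 ->
    (`|derive1 (fun y => f y / phi1 y) t - b2 * derive1 u t| <= e * `|derive1 u t|) =
    (`|b2 - f2s t| <= e).
  move=> It df; have dg := g_is_derive It df.
  rewrite (derive1E (fun y => f y / phi1 y)) derive_val -mulrBl normrM distrC.
  by rewrite ler_pM2r// normr_gt0 u1_neq0.
split=> [H|/cvgrPdist_le H]; [apply/cvgrPdist_le|] => e /H; apply: filter_app;
  apply: near_D => t It df; rewrite E//.
Qed.

Let w y := phi1 y / phi2 y.

Let w_deriv t : I t -> is_derive t 1 w (- (W t / phi2 t ^+ 2)).
Proof.
move=> It; apply: (is_derive_eq (is_derive_div (hphi2 It) (d1 It) (d2 It))).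
by rewrite /Wr; field; exact: hphi2.
Qed.

(** The derivative of [f / phi2] is [f1s] times that of [w], and the latter divides out. The factor
    [phi2 / phi1] survives as [u], so the condition prescribes a rate for [f1s - b1] and not only
    its limit. *)
Lemma v_second b1 :
  little_o fx0 (fun x => derive1 (fun y => f y / phi2 y) x - b1 * derive1 (fun y => phi1 y / phi2 y) x)
    (fun x => phi2 x / phi1 x * derive1 (fun y => phi1 y / phi2 y) x) <->
  little_o fx0 (fun t => f1s t - b1) u.
Proof.
have E t e : I t -> derivable f t 1 ->
    (`|derive1 (fun y => f y / phi2 y) t - b1 * derive1 w t| <= e * `|phi2 t / phi1 t * derive1 w t|) =
    (`|f1s t - b1| <= e * `|u t|).
  move=> It /derivable_is_derive df; have dw := w_deriv It.
  have w0 := hW It; have p0 := hphi2 It.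
  have dg : is_derive t 1 (fun y => f y / phi2 y) (f1s t * derive1 w t).
    apply: (is_derive_eq (is_derive_div p0 df (d2 It))).
    rewrite (derive1E w) derive_val /fstar1; move: w0; set ww := W t => w0.
    by rewrite /Wr; field; rewrite ?w0 ?p0.
  rewrite (derive1E (fun y => f y / phi2 y)) derive_val -mulrBl (normrM (f1s t - b1)) (normrM (phi2 t / phi1 t)) mulrA ler_pM2r//.
  rewrite normr_gt0 (derive1E w) derive_val oppr_eq0 mulf_neq0// invr_eq0 expf_neq0//.
split=> H e /H; apply: filter_app; apply: near_D => t It df; rewrite E//.
Qed.

Lemma limits_iv a1 a2 : limits a1 a2 -> cond_iv x0 phi1 phi2 f a1 a2.
Proof. by move=> Q; split; [exact: limits_expansion|apply/iv_second; exact: Q.1]. Qed.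

Lemma iv_limits b1 b2 : cond_iv x0 phi1 phi2 f b1 b2 -> limits b1 b2.
Proof. by move=> [/expansion_cvg h1 /iv_second h2]. Qed.

(** By [fstar1E], [f1s - a1] splits into the error of the expansion divided by [phi1] and [a2 - f2s]
    times [u]; each part is o(u). *)
Lemma limits_v a1 a2 : limits a1 a2 -> cond_v x0 phi1 phi2 f a1 a2.
Proof.
move=> Q; split; first exact: limits_expansion.
apply/v_second => e e0; have e2 : 0 < e / 2 by rewrite divr_gt0.
have /expansionP/(_ _ e2) H1 := limits_expansion Q.
have /cvgrPdist_le/(_ _ e2) H2 := Q.1.
have H1' : \forall t \near fx0, `|a1 - (f t / phi1 t - a2 * u t)| <= e / 2 * `|u t|.
  by apply: filterS H1 => t Ht _.
move: H1' H2; apply: filter_app2; apply: near_D => t It _ H1' H2.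
rewrite fstar1E//.
have -> : f t / phi1 t - f2s t * u t - a1 =
  - (a1 - (f t / phi1 t - a2 * u t)) + (a2 - f2s t) * u t by ring.
rewrite (le_trans (ler_normD _ _))// (splitr e) (mulrDl (e / 2)) lerD ?normrN//.
by rewrite normrM ler_wpM2r.
Qed.

(** The same splitting is solved for [b2 - f2s] times [u] and divided by [u]: the rate o(u) is what
    recovers the limit of [f2s]. *)
Lemma v_limits b1 b2 : cond_v x0 phi1 phi2 f b1 b2 -> limits b1 b2.
Proof.
move=> [h1 /v_second h2]; split; last exact: expansion_cvg.
apply/cvgrPdist_le => e e0; have e2 : 0 < e / 2 by rewrite divr_gt0.
have /expansionP/(_ _ e2) H1 := h1; have H2 := h2 _ e2.
have H1' : \forall t \near fx0, `|b1 - (f t / phi1 t - b2 * u t)| <= e / 2 * `|u t|.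
  by apply: filterS H1 => t Ht _.
move: H1' H2; apply: filter_app2; apply: near_D => t It _ H1' H2.
have u0 : 0 < `|u t| by rewrite normr_gt0 mulf_neq0 ?invr_eq0 ?hphi1 ?hphi2.
rewrite -(ler_pM2r u0) -normrM.
have -> : (b2 - f2s t) * u t = (f1s t - b1) + (b1 - (f t / phi1 t - b2 * u t)).
  by rewrite fstar1E//; ring.
by rewrite (le_trans (ler_normD _ _))// (splitr e) (mulrDl (e / 2)) lerD.
Qed.

Lemma iii_limits b1 b2 : cond_iii x0 phi1 phi2 f b1 b2 -> limits b1 b2.
Proof.
move=> [h1 /limits_exist[a1 Q]].
by rewrite (cvg_unique (@Rhausdorff R) h1 (limits_fstar1 Q)).
Qed.

(** * Integral representations *)

Lemma rep_imp_int_ae c (h k : R -> R) x L : T <= c -> Iset c x0 x ->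
  {ae mu, forall t, I t -> h t = k t} -> imp_int x0 h x L -> imp_int x0 k x L.
Proof.
move=> Tc [cx xx0] hk [ih lh].
have hk' b : (b%:E < x0)%E -> {ae mu, forall t, `[x, b]%classic t -> h t = k t}.
  move=> bx0; apply: filterS hk => t H; rewrite /= in_itv/= => /andP[xt tb].
  apply: H; split; first by rewrite (le_trans Tc)// (le_trans cx).
  by apply: le_lt_trans bx0; rewrite lee_fin.
split; first by move=> b bx0; apply: ae_integrable (hk' _ bx0) (ih _ bx0); exact: lmu_itv.
apply: cvg_trans lh; apply: near_eq_cvg; apply: near_I => b [_ bx0].
by apply: ae_Rintegral (hk' _ bx0) (ih _ bx0); exact: lmu_itv.
Qed.

(* fstar1, fstar2 and Fstar are unspecified where f is not differentiable, so the
   remainders F-bar and f2-bar of (vi) and (vii) are set to 0 there. *)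
Let reg (h : R -> R) (l t : R) : R := if `[< derivable f t 1 >] then h t - l else 0.

Let reg_ae h l : {ae mu, forall t, I t -> h t - l = reg h l t}.
Proof.
have [sg _ S] := setup_phi1.
by apply: filterS (ae_derivable S) => t H /H df; rewrite /reg asboolT.
Qed.

Let reg_small h l : h @ fx0 --> l -> little_o (to_x0 x0) (reg h l) (fun=> 1).
Proof.
move=> /cvgrPdist_le H e e0.
have : to_x0 x0 (fun t => Dset f t -> `|l - h t| <= e) := H _ e0.
apply: filterS => t Ht.
rewrite normr1 mulr1 /reg; case: asboolP => [df|_]; last by rewrite normr0 ltW.
by rewrite distrC; exact: Ht.
Qed.

Let fstar2_integrable a b : T <= a -> (b%:E < x0)%E -> mu.-integrable `[a, b] (EFin \o f2s).
Proof. by move=> Ta bx0; have [sg _ S] := setup_phi1; exact: coef_integrable S _ _ Ta bx0. Qed.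

Let cst_integrable a b l : mu.-integrable `[a, b] (EFin \o (fun=> l)).
Proof. by apply: continuous_lmu_integrable; apply/subspace_continuousP => x _; exact: cvg_cst. Qed.

(** Summability down to [T] is out of reach of [setup_Phi]; it comes from [FstarE], which combines
    [f / phi1] and [f2s] with weights continuous at [T] too. *)
Let Fstar_integrable a b : T <= a -> (b%:E < x0)%E -> mu.-integrable `[a, b] (EFin \o Fs).
Proof.
move=> Ta bx0.
have sI t : `[a, b]%classic t -> I t.
  rewrite /= in_itv/= => /andP[at_ tb]; split; first exact: le_trans at_.
  by apply: le_lt_trans bx0; rewrite lee_fin.
have i1 : mu.-integrable `[a, b] (EFin \o (fun t => - phi1 T * (f t / phi1 t))).
  apply: lmu_integrableZl; apply: continuous_lmu_integrable; apply: ac_continuous.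
  by apply: acM; [apply: acW (f_ac bx0)|exact: inv_phi1_ac].
have i2 : mu.-integrable `[a, b] (EFin \o (fun t => f2s t * (phi2 T - phi1 T * u t))).
  apply: integrableM_continuous (fstar2_integrable Ta bx0).
  apply: (continuous_subspaceW sI); apply/subspace_continuousP => t It.
  apply: cvgB; first exact: cvg_cst.
  by apply: cvgMr; exact: is_derive_within_cvg (u_deriv It).
have := lmu_integrableB i2 i1; apply: eq_integrable; first exact: lmu_itv.
by move=> t /set_mem/sI It; rewrite /= FstarE//; congr EFin; ring.
Qed.

Let reg_summable h l : (forall a b, T <= a -> (b%:E < x0)%E -> mu.-integrable `[a, b] (EFin \o h)) ->
  loc_summable T x0 (reg h l).
Proof.
move=> ih a b Ta bx0; apply: (@ae_integrable _ _ (fun t => h t - l)); first exact: lmu_itv.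
  apply: filterS (reg_ae h l) => t H; rewrite /= in_itv/= => /andP[at_ tb].
  apply: H; split; first exact: le_trans at_.
  by apply: le_lt_trans bx0; rewrite lee_fin.
by apply: lmu_integrableB; [exact: ih|exact: cst_integrable].
Qed.

(** This is [a1 * phi1 + a2 * phi2] rewritten in the basis [P], [phi1]: its coordinates are
    [- (a2 / phi1 T)] and [gamma / phi1 T], with [gamma] standing for
    [a1 * phi1 T + a2 * phi2 T]. *)
Let rep_Phi_eq a1 a2 x : I x -> T < x ->
  f x = a1 * phi1 x + a2 * phi2 x -
    P x * (- (a2 / phi1 T) - (f x / P x - (a1 * phi1 T + a2 * phi2 T) * v x)).
Proof.
move=> Ix Tx; have P0 := Phi_neq0 Ix Tx; have T0 := hphi1 IT.
have -> : P x * (- (a2 / phi1 T) - (f x / P x - (a1 * phi1 T + a2 * phi2 T) * v x)) =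
   - (a2 / phi1 T * P x) - f x + (a1 * phi1 T + a2 * phi2 T) * phi1 x / phi1 T.
  by rewrite /v; field; rewrite P0 T0.
by rewrite /Phi; field.
Qed.

Lemma limits_rep_vi a1 a2 : limits a1 a2 ->
  rep_vi T x0 phi1 phi2 f a1 a2 (fun t => Fs t - (a1 * phi1 T + a2 * phi2 T)).
Proof.
move=> Q x Tx xx0; have [sg [sg1 sgW]] := Wr_sign.
(* The setup is started at [x] itself, so every point beyond [T] is reached. *)
have S := setup_Phi sg1 sgW Tx xx0.
have Ix : I x by split => //; exact: ltW.
exists (- (a2 / phi1 T) - (f x / P x - (a1 * phi1 T + a2 * phi2 T) * v x)); split.
  by apply: (remainder_imp_int S (limits_remainder_Phi Q)); split.
exact: rep_Phi_eq.
Qed.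

Lemma limits_vi a1 a2 : limits a1 a2 ->
  exists Fb, cond_vi T x0 phi1 phi2 f a1 a2 Fb.
Proof.
move=> Q; exists (reg Fs (a1 * phi1 T + a2 * phi2 T)); split.
  by apply: reg_summable => a b; exact: Fstar_integrable.
split; first by apply: reg_small; exact: limits_Fstar.
move=> x Tx xx0; have [L [iL fL]] := limits_rep_vi Q Tx xx0; exists L; split => //.
apply: (@rep_imp_int_ae T) iL => //; first by split => //; exact: ltW.
by apply: filterS (reg_ae Fs (a1 * phi1 T + a2 * phi2 T)) => t H /H ->.
Qed.

Let vi_rep b1 b2 Fb c : T < c -> rep_vi T x0 phi1 phi2 f b1 b2 Fb ->
  forall x, Iset c x0 x -> exists L,
    imp_int x0 (fun t => W t / P t ^+ 2 * Fb t) x L /\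
    f x / P x = - (b2 / phi1 T) + (b1 * phi1 T + b2 * phi2 T) * v x - L.
Proof.
move=> Tc H x [cx xx0]; have Tx := lt_le_trans Tc cx.
have Ix : I x by split => //; exact: ltW.
have [L [iL fL]] := H _ Tx xx0; exists L; split => //.
have P0 := Phi_neq0 Ix Tx; have T0 := hphi1 IT.
apply: (mulIf P0); rewrite mulfVK// fL /v.
have -> : (- (b2 / phi1 T) + (b1 * phi1 T + b2 * phi2 T) * (phi1 x / (phi1 T * P x)) - L) * P x
  = - (b2 / phi1 T * P x) + (b1 * phi1 T + b2 * phi2 T) * phi1 x / phi1 T - P x * L.
  by field; rewrite P0 T0.
by congr (_ - _); rewrite /Phi; field.
Qed.

(** The constant of the representation, [- (b2 / phi1 T)], is the limit of the remainder and
    determines the limit [b2] of [f2s]. Then [b1] follows by comparing two expressions for the limit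
    of [Fs], as [phi1 T] is nonzero. *)
Lemma vi_limits b1 b2 Fb : cond_vi T x0 phi1 phi2 f b1 b2 Fb -> limits b1 b2.
Proof.
move=> [_ [Fo H]]; have [sg [sg1 sgW]] := Wr_sign; have [c Tc cx0] := ex_between hTx0.
have S := setup_Phi sg1 sgW Tc cx0; have H' := vi_rep Tc H.
have hF := rep_coef_lim S Fo H'; have hl := rep_remainder_cvg S H'.
have [l [hl' h2]] := Fstar_cvg hF.
have lE := cvg_unique (@Rhausdorff R) hl hl'.
have T0 := hphi1 IT.
have {}h2 : f2s @ fx0 --> b2.
  by rewrite (_ : b2 = - (phi1 T * l))// -lE; field.
have [a1 Q] := limits_exist h2.
have gE : b1 * phi1 T + b2 * phi2 T = a1 * phi1 T + b2 * phi2 T.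
  exact: cvg_unique hF (limits_Fstar Q).
by rewrite (mulIf T0 (addIr _ gE)).
Qed.

Lemma vi_unique b1 b2 Fb : cond_vi T x0 phi1 phi2 f b1 b2 Fb ->
  {ae mu, forall t, I t -> Fb t = Fs t - (b1 * phi1 T + b2 * phi2 T)}.
Proof.
move=> [_ [Fo H]]; apply: ae_Iset_gt => c Tc cx0.
have [sg [sg1 sgW]] := Wr_sign; have S := setup_Phi sg1 sgW Tc cx0.
exact: (rep_unique S (vi_rep Tc H)).
Qed.

Lemma limits_rep_vii a1 a2 : limits a1 a2 ->
  rep_vii T x0 phi1 phi2 f a1 a2 (fun t => f2s t - a2).
Proof.
move=> Q x Ix; have [sg _ S] := setup_phi1.
exists (a1 - (f x / phi1 x - a2 * u x)); split.
  exact: (remainder_imp_int S Q.2 Ix).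
by have p0 := hphi1 Ix; rewrite /u; field.
Qed.

Lemma limits_vii a1 a2 : limits a1 a2 ->
  exists fb2, cond_vii T x0 phi1 phi2 f a1 a2 fb2.
Proof.
move=> Q; exists (reg f2s a2); split.
  by apply: reg_summable => a b; exact: fstar2_integrable.
split; first by apply: reg_small; exact: Q.1.
move=> x Ix; have [L [iL fL]] := limits_rep_vii Q Ix; exists L; split => //.
apply: (@rep_imp_int_ae T) iL => //.
by apply: filterS (reg_ae f2s a2) => t H /H ->.
Qed.

Let vii_rep b1 b2 fb2 : rep_vii T x0 phi1 phi2 f b1 b2 fb2 ->
  forall x, I x -> exists L,
    imp_int x0 (fun t => derive1 u t * fb2 t) x L /\
    f x / phi1 x = b1 + b2 * u x - L.
Proof.
move=> H x Ix; have [L [iL fL]] := H _ Ix; exists L; split => //.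
by have p0 := hphi1 Ix; rewrite fL /u; field.
Qed.

Lemma vii_limits b1 b2 fb2 : cond_vii T x0 phi1 phi2 f b1 b2 fb2 -> limits b1 b2.
Proof.
move=> [_ [Fo /vii_rep H]]; have [sg _ S] := setup_phi1.
by split; [exact: (rep_coef_lim S Fo H)|exact: (rep_remainder_cvg S H)].
Qed.

Lemma vii_unique b1 b2 fb2 : cond_vii T x0 phi1 phi2 f b1 b2 fb2 ->
  {ae mu, forall t, I t -> fb2 t = f2s t - b2}.
Proof.
move=> [_ [Fo /vii_rep H]]; have [sg _ S] := setup_phi1.
exact: (rep_unique S H).
Qed.

(** * Limits of the weighted improper integrals *)

Lemma limits_error a1 a2 : limits a1 a2 ->
  (fun x => (f x - (a1 * phi1 x + a2 * phi2 x)) / phi2 x) @ to_x0 x0 --> 0.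
Proof.
move=> /limits_expansion H; apply/cvgrPdist_le => e /H; apply: filter_app.
apply: near_I => x Ix Hx; rewrite sub0r normrN normrM normfV.
by rewrite ler_pdivrMr// normr_gt0 hphi2.
Qed.

(** The tail integral equals [a1 - f / phi1]; multiplied by [phi1 / phi2] it is [- a2] minus the
    relative error of the expansion. *)
Lemma limits_J a1 a2 : limits a1 a2 -> exists J : R -> R,
  (forall x, I x -> imp_int x0 (fun t => derive1 (fun y => phi2 y / phi1 y) t * f2s t) x (J x)) /\
  (fun x => phi1 x / phi2 x * J x) @ to_x0 x0 --> - a2.
Proof.
move=> Q; have [sg _ S] := setup_phi1.
exists (fun x => a1 - f x / phi1 x); split.
  by move=> x Ix; exact: (quotient_imp_int S (limits_fphi1 Q) Ix).
apply: (@eq_cvg_I (fun x => - ((f x - (a1 * phi1 x + a2 * phi2 x)) / phi2 x) - a2)).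
  by move=> x Ix; have p1 := hphi1 Ix; have p2 := hphi2 Ix; field; rewrite p1 p2.
have : (fun x => - ((f x - (a1 * phi1 x + a2 * phi2 x)) / phi2 x) - a2) @ to_x0 x0 --> - 0 - a2.
  by apply: cvgB; [apply: cvgN; exact: limits_error|exact: cvg_cst].
by rewrite oppr0 add0r.
Qed.

(** As [f / P] tends to [a1 / phi2 T], the tail is the difference of the two, and its product with
    [P / phi2] is again a constant minus the relative error. *)
Lemma limits_K a1 a2 : limits a1 a2 -> exists K : R -> R,
  (forall x, T < x -> (x%:E < x0)%E ->
     imp_int x0 (fun t => W t / (P t ^+ 2) * Fs t) x (K x)) /\
  (fun x => P x / phi2 x * K x) @ to_x0 x0 --> - ((a1 * phi1 T + a2 * phi2 T) / phi2 T).
Proof.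
move=> Q; have [sg [sg1 sgW]] := Wr_sign; have T0 := hphi1 IT; have T2 := hphi2 IT.
exists (fun x => a1 / phi2 T - f x / P x); split.
  move=> x Tx xx0; have S := setup_Phi sg1 sgW Tx xx0.
  have := quotient_cvg S (limits_remainder_Phi Q).
  rewrite (_ : - (a2 / phi1 T) + _ = a1 / phi2 T); last by field; rewrite T0 T2.
  by move=> h; apply: (quotient_imp_int S h); split.
set k := (a1 * phi1 T + a2 * phi2 T) / phi2 T.
have : (fun x => - ((f x - (a1 * phi1 x + a2 * phi2 x)) / phi2 x) - k) @ to_x0 x0 --> - 0 - k.
  by apply: cvgB; [apply: cvgN; exact: limits_error|exact: cvg_cst].
rewrite oppr0 add0r; apply: cvg_trans; apply: near_eq_cvg.
apply: filterS (near_to_x0 hTx0) => x [Tx xx0].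
have Ix : I x by split => //; exact: ltW.
have P0 := Phi_neq0 Ix Tx; have p2 := hphi2 Ix.
have -> : P x / phi2 x * (a1 / phi2 T - f x / P x) = (a1 / phi2 T * P x - f x) / phi2 x.
  by field; rewrite P0 p2 T2.
by rewrite /k /Phi; field; rewrite p2 T2.
Qed.

End expansions.

(** * Equivalence of the properties and its consequences *)

Unset Implicit Arguments.
Set Strict Implicit.

Theorem theorem4p5 (R : realType) (x0 : \bar R) (T : R) (phi1 phi2 f : R -> R)
  (hTx0 : (T%:E < x0)%E)
  (hC1 : C1_on T x0 phi1) (hC2 : C1_on T x0 phi2)
  (ho21 : little_o (to_x0 x0) phi2 phi1)
  (hphi1 : forall x, Iset T x0 x -> phi1 x != 0)
  (hphi2 : forall x, Iset T x0 x -> phi2 x != 0)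
  (hW : forall x, Iset T x0 x -> Wr phi1 phi2 x != 0)
  (hf : AC_on T x0 f) :
  let fx0 := to_x0_D x0 f in
  (* equivalences: each of (ii)..(vii) is equivalent to (i) *)
  ((prop_i T x0 phi1 phi2 f <-> prop_ii x0 phi1 phi2 f) /\
   (prop_i T x0 phi1 phi2 f <-> exists a1 a2, cond_iii x0 phi1 phi2 f a1 a2) /\
   (prop_i T x0 phi1 phi2 f <-> exists a1 a2, cond_iv x0 phi1 phi2 f a1 a2) /\
   (prop_i T x0 phi1 phi2 f <-> exists a1 a2, cond_v x0 phi1 phi2 f a1 a2) /\
   (prop_i T x0 phi1 phi2 f <-> exists a1 a2 Fb, cond_vi T x0 phi1 phi2 f a1 a2 Fb) /\
   (prop_i T x0 phi1 phi2 f <-> exists a1 a2 fb2, cond_vii T x0 phi1 phi2 f a1 a2 fb2)) /\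
  (* moreover, when these hold: *)
  (prop_i T x0 phi1 phi2 f ->
   exists a1 a2 gamma : R,
     fstar1 phi1 phi2 f @ fx0 --> a1 /\
     fstar2 phi1 phi2 f @ fx0 --> a2 /\
     Fstar T phi1 phi2 f @ fx0 --> gamma /\
     gamma = a1 * phi1 T + a2 * phi2 T /\
     (forall b1 b2, cond_iii x0 phi1 phi2 f b1 b2 -> b1 = a1 /\ b2 = a2) /\
     (forall b1 b2, cond_iv x0 phi1 phi2 f b1 b2 -> b1 = a1 /\ b2 = a2) /\
     (forall b1 b2, cond_v x0 phi1 phi2 f b1 b2 -> b1 = a1 /\ b2 = a2) /\
     (forall b1 b2 Fb, cond_vi T x0 phi1 phi2 f b1 b2 Fb ->
        b1 = a1 /\ b2 = a2 /\
        {ae @lmu R, forall t, Iset T x0 t ->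
                      Fb t = Fstar T phi1 phi2 f t - gamma}) /\
     (forall b1 b2 fb2, cond_vii T x0 phi1 phi2 f b1 b2 fb2 ->
        b1 = a1 /\ b2 = a2 /\
        {ae @lmu R, forall t, Iset T x0 t ->
                      fb2 t = fstar2 phi1 phi2 f t - a2}) /\
     (exists J : R -> R,
        (forall x, Iset T x0 x ->
           imp_int x0 (fun t => derive1 (fun y => phi2 y / phi1 y) t
                                * fstar2 phi1 phi2 f t) x (J x)) /\
        (fun x => phi1 x / phi2 x * J x) @ to_x0 x0 --> - a2) /\
     (exists K : R -> R,
        (forall x, T < x -> (x%:E < x0)%E ->
           imp_int x0 (fun t => Wr phi1 phi2 t / (Phi T phi1 phi2 t ^+ 2)
                                * Fstar T phi1 phi2 f t) x (K x)) /\
        (fun x => Phi T phi1 phi2 x / phi2 x * K x) @ to_x0 x0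
          --> - (gamma / phi2 T)) /\
     rep_vii T x0 phi1 phi2 f a1 a2 (fun t => fstar2 phi1 phi2 f t - a2) /\
     rep_vi T x0 phi1 phi2 f a1 a2 (fun t => Fstar T phi1 phi2 f t - gamma)).
Proof.
move=> fx0.
(* Each property is shown to imply [limits] with its own constants, so that equality of the
   constants reduces to uniqueness for [limits]. *)
have of_i : prop_i T x0 phi1 phi2 f -> exists a1 a2, limits x0 phi1 phi2 f a1 a2.
  by move=> [ga hF]; apply: (limits_of_i (T := T)) hF.
have of_ii a2 : fstar2 phi1 phi2 f @ fx0 --> a2 -> exists a1, limits x0 phi1 phi2 f a1 a2.
  by move=> h2; apply: (limits_exist (T := T)) h2.
have of_iii b1 b2 : cond_iii x0 phi1 phi2 f b1 b2 -> limits x0 phi1 phi2 f b1 b2.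
  by move=> h; apply: (iii_limits (T := T)) h.
have of_iv b1 b2 : cond_iv x0 phi1 phi2 f b1 b2 -> limits x0 phi1 phi2 f b1 b2.
  by move=> h; apply: (iv_limits (T := T)) h.
have of_v b1 b2 : cond_v x0 phi1 phi2 f b1 b2 -> limits x0 phi1 phi2 f b1 b2.
  by move=> h; apply: (v_limits (T := T)) h.
have of_vi b1 b2 Fb : cond_vi T x0 phi1 phi2 f b1 b2 Fb -> limits x0 phi1 phi2 f b1 b2.
  by move=> h; apply: (vi_limits (T := T)) h.
have of_vii b1 b2 fb2 : cond_vii T x0 phi1 phi2 f b1 b2 fb2 -> limits x0 phi1 phi2 f b1 b2.
  by move=> h; apply: (vii_limits (T := T)) h.
have to_F a1 a2 : limits x0 phi1 phi2 f a1 a2 ->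
    Fstar T phi1 phi2 f @ fx0 --> a1 * phi1 T + a2 * phi2 T.
  by move=> Q; apply: (limits_Fstar (T := T)) Q.
have to_i a1 a2 : limits x0 phi1 phi2 f a1 a2 -> prop_i T x0 phi1 phi2 f.
  by move=> /to_F; exists (a1 * phi1 T + a2 * phi2 T).
have to_1 a1 a2 : limits x0 phi1 phi2 f a1 a2 -> fstar1 phi1 phi2 f @ fx0 --> a1.
  by move=> Q; apply: (limits_fstar1 (T := T)) Q.
have uniq a1 a2 b1 b2 : limits x0 phi1 phi2 f a1 a2 -> limits x0 phi1 phi2 f b1 b2 ->
    b1 = a1 /\ b2 = a2.
  by move=> Qa Qb; apply: (limits_unique (T := T)) Qa Qb.
split.
  split.
    by split=> [/of_i[a1 [a2 [h2 _]]]|[a2 /of_ii[a1 /to_i]]//]; exists a2.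
  split.
    split=> [/of_i[a1 [a2 Q]]|[a1 [a2 /of_iii/to_i]]//].
    by exists a1, a2; split; [exact: to_1 Q|exact: Q.1].
  split.
    split=> [/of_i[a1 [a2 Q]]|[a1 [a2 /of_iv/to_i]]//].
    by exists a1, a2; apply: (limits_iv (T := T)) Q.
  split.
    split=> [/of_i[a1 [a2 Q]]|[a1 [a2 /of_v/to_i]]//].
    by exists a1, a2; apply: (limits_v (T := T)) Q.
  split.
    split=> [/of_i[a1 [a2 Q]]|[a1 [a2 [Fb /of_vi/to_i]]]//].
    by exists a1, a2; apply: (limits_vi (T := T)) Q.
  split=> [/of_i[a1 [a2 Q]]|[a1 [a2 [fb2 /of_vii/to_i]]]//].
  by exists a1, a2; apply: (limits_vii (T := T)) Q.
move=> /of_i[a1 [a2 Q]]; exists a1, a2, (a1 * phi1 T + a2 * phi2 T).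
split; first exact: to_1 Q.
split; first exact: Q.1.
split; first exact: to_F.
split; first by [].
split; first by move=> b1 b2 /of_iii; exact: uniq.
split; first by move=> b1 b2 /of_iv; exact: uniq.
split; first by move=> b1 b2 /of_v; exact: uniq.
split.
  move=> b1 b2 Fb h; have [e1 e2] := uniq _ _ _ _ Q (of_vi _ _ _ h).
  by split => //; split => //; rewrite -e1 -e2; apply: (vi_unique (T := T)) h.
split.
  move=> b1 b2 fb2 h; have [e1 e2] := uniq _ _ _ _ Q (of_vii _ _ _ h).
  by split => //; split => //; rewrite -e2; apply: (vii_unique (T := T)) h.
split; first by apply: (limits_J (T := T)) Q.
split; first by apply: (limits_K (T := T)) Q.
split; first by apply: (limits_rep_vii (T := T)) Q.
by apply: (limits_rep_vi (T := T)) Q.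
Qed.
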